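(* The $\mathbb{C}[[h]]$-module $\mathcal{L}_1(\mathfrak{sl}_2)=\{e^{\lambda_1}v: v\in\mathcal{L}_0(\mathfrak{sl}_2)\}\subset\mathcal{F}_1$ is a module for the double Yangian $\mathrm{DY}(\mathfrak{sl}_2)$ (with respect to the level 1 action of $\mathrm{DY}(\mathfrak{sl}_2)$ on $\mathcal{F}_1$ described in the context).
   Context: Double Yangian. Let $I$ be the identity and $P$ the permutation operator on $\mathbb{C}^2\otimes\mathbb{C}^2$, and $R(u)=\frac{1}{1+h/u}\left(I+\frac{h}{u}P\right)$. $\mathrm{DY}(\mathfrak{gl}_2)$ is the ($h$-adically completed) associative algebra over $\mathbb{C}[[h]]$ generated by a central element $C$ and $t_{ij}^{(r)}$, $i,j=1,2$, $r\in\mathbb{Z}$, subject to $R_{12}(u-v)T_{13}^{\pm}(u)T_{23}^{\pm}(v)=T_{23}^{\pm}(v)T_{13}^{\pm}(u)R_{12}(u-v)$ and $R_{12}(u-v-hC/2)T_{13}^{+}(u)T_{23}^{-}(v)=T_{23}^{-}(v)T_{13}^{+}(u)R_{12}(u-v+hC/2)$, where $T^{\pm}(u)=\sum_{i,j}e_{ij}\otimes t_{ij}^{\pm}(u)$, $t_{ij}^+(u)=\delta_{ij}-h\sum_{r\geq 0}t_{ij}^{(r)}u^{-r-1}$, $t_{ij}^-(u)=\delta_{ij}+h\sum_{r\geq 1}t_{ij}^{(-r)}u^{r-1}$. Set $k_1^{\pm}(u)=t_{11}^{\pm}(u)$, $k_2^{\pm}(u)=t_{22}^{\pm}(u)-t_{21}^{\pm}(u)t_{11}^{\pm}(u)^{-1}t_{12}^{\pm}(u)$,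 $X^+(u)=t_{11}^+(u-hC/4)^{-1}t_{12}^+(u-hC/4)-t_{11}^-(u+hC/4)^{-1}t_{12}^-(u+hC/4)$, $X^-(u)=t_{21}^+(u+hC/4)t_{11}^+(u+hC/4)^{-1}-t_{21}^-(u-hC/4)t_{11}^-(u-hC/4)^{-1}$, $X_{\pm\alpha}(u)=h^{-1}X^\pm(u)$. The double Yangian $\mathrm{DY}(\mathfrak{sl}_2)$ is the ($h$-adically completed) subalgebra generated by $C$ and all coefficients of $E(u)=X_\alpha(u+h/2)$, $F(u)=X_{-\alpha}(u+h/2)$, $H^{\pm}(u)=k_2^{\pm}(u+h/2)k_1^{\pm}(u+h/2)^{-1}$. Fock spaces. Let $\varepsilon_1,\varepsilon_2$ be the basis dual to $e_{11},e_{22}$, with form $(\varepsilon_j,\varepsilon_k)=\delta_{jk}$; $\alpha=\varepsilon_1-\varepsilon_2$, $Q=\mathbb{Z}\alpha$, $\lambda_0=0$, $\lambda_1=\alpha/2$. Let $\widehat{\mathfrak{s}}$ be the Lie algebra generated by central $C$ and $a_j(r)$ ($j=1,2$, $r\in\mathbb{Z}\setminus\{0\}$) with $[a_j(r),a_k(s)]=r\delta_{jk}\delta_{r+s,0}C$, and $\widehat{\mathfrak{s}}^-$ the subalgebra generated by $a_j(r)$, $r<0$. For $i=0,1$ let $\mathcal{F}_i=U(\widehat{\mathfrak{s}}^-)[[h]]\otimes\mathbb{C}[Q][[h]]e^{\lambda_i}$ ($h$-adically completed), $\boldsymbol{1}=1\otimes1\in\mathcal{F}_0$. On $f\otimes e^\mu$: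 $C$ acts as $1$; $a_j(r)$ acts by $a_j(r)f\otimes e^\mu$ for $r<0$ and by $[a_j(r),f]\otimes e^\mu$ for $r>0$; $\partial_{\varepsilon_j}(f\otimes e^\mu)=(\varepsilon_j,\mu)f\otimes e^\mu$ ($\partial_\beta$ linear in $\beta$); $e^{\beta}(f\otimes e^\mu)=f\otimes e^{\beta+\mu}$ (so $e^{\lambda_1}:\mathcal{F}_0\to\mathcal{F}_1$). Put $E^-(u)=\exp\big(\sum_{r>0}\big(-\frac{a_1(-r)}{r}(u-\frac34h)^r+\frac{a_2(-r)}{r}(u+\frac h4)^r\big)\big)$, $E^+(u)=\exp\big(\sum_{r>0}\frac{a_1(r)-a_2(r)}{r}(u+\frac h4)^{-r}\big)$, $\mathcal{E}^-(u)=E^-(0)^{-1}E^-(u)$. Action. Each $\mathcal{F}_i$ is a $\mathrm{DY}(\mathfrak{gl}_2)$-module with $C$ acting as $1$ and $X_\alpha(u)=\mathcal{E}^-(u)E^+(u)e^\alpha u^{\partial_{\alpha/2}}(u+h)^{\partial_{\alpha/2}}$, $X_{-\alpha}(u)=\mathcal{E}^-(u+h/2)^{-1}E^+(u-h/2)^{-1}e^{-\alpha}(u-h/2)^{-\partial_{\alpha/2}}(u+h/2)^{-\partial_{\alpha/2}}$, $k_j^+(u)=\exp\big(-\sum_{r>0}\frac{a_j(r)}{r}((u+\frac h2)^{-r}-(u-\frac h2)^{-r})\big)\,c_j(u)^{\partial_{\alpha/2}}$ with $c_1(u)=\frac{u+h/4}{u+5h/4}$, $c_2(u)=\frac{u+h/4}{u-3h/4}$,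 $k_1^-(u)=\exp\big(\sum_{r>0}\frac{a_2(-r)}{r}((u+h)^r-u^r)\big)$, $k_2^-(u)=\exp\big(\sum_{r>0}\frac{a_1(-r)}{r}(u^r-(u-h)^r)\big)$. Expressions such as $(u+ah)^p$ are expanded in nonnegative powers of $h$. The submodule. Write $X_\alpha(u)=\sum_{r\in\mathbb{Z}}x(r)u^{-r-1}$. Let $B_{W_0}\subset\mathcal{F}_0$ be the set of all $x(r_n)\cdots x(r_1)\boldsymbol{1}$ with $n\geq0$, $r_1\leq-1$ and $r_{j+1}\leq r_j-2$ for $j=1,\ldots,n-1$. Then $\mathcal{L}_0(\mathfrak{sl}_2)\subset\mathcal{F}_0$ is the $h$-adically completed $\mathbb{C}[[h]]$-span of $\{e^{k\alpha}b: k\in\mathbb{Z},\,b\in B_{W_0}\}$. *)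

(* Defs.v *)
From HB Require Import structures.
From mathcomp Require Import all_boot all_order all_algebra.
From mathcomp Require Import finmap monalg complex.
From mathcomp Require Import boolp classical_sets cardinality fsbigop reals.

Set Implicit Arguments.
Unset Strict Implicit.
Unset Printing Implicit Defensive.

Import GRing.Theory.
Local Open Scope classical_set_scope.
Local Open Scope ring_scope.

(** * Formal power series in h *)

(* [pser A] is A[[h]]; [x n] is the coefficient of h^n. *)
Definition pser (A : Type) : Type := nat -> A.

HB.instance Definition _ (A : Type) := gen_eqMixin (pser A).
HB.instance Definition _ (A : Type) := gen_choiceMixin (pser A).

Section PserZmodule.
Variable A : zmodType.
Implicit Types x y z : pser A.

Definition pser_zero : pser A := fun=> 0.
Definition pser_opp x : pser A := fun n => - x n.
Definition pser_add x y : pser A := fun n => x n + y n.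

Lemma pser_addA : associative pser_add.
Proof. by move=> x y z; apply/funext => n; rewrite /pser_add addrA. Qed.
Lemma pser_addC : commutative pser_add.
Proof. by move=> x y; apply/funext => n; rewrite /pser_add addrC. Qed.
Lemma pser_add0 : left_id pser_zero pser_add.
Proof. by move=> x; apply/funext => n; rewrite /pser_add add0r. Qed.
Lemma pser_addN : left_inverse pser_zero pser_opp pser_add.
Proof. by move=> x; apply/funext => n; rewrite /pser_add addNr. Qed.

HB.instance Definition _ := GRing.isZmodule.Build (pser A)
  pser_addA pser_addC pser_add0 pser_addN.

Lemma pserDE x y n : (x + y) n = x n + y n. Proof. by []. Qed.
End PserZmodule.

Lemma cauchy_exchange (V : zmodType) (F : nat -> nat -> nat -> V) (n : nat) :
  \sum_(k < n.+1) \sum_(j < k.+1) F j (k - j)%N (n - k)%N =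
  \sum_(j < n.+1) \sum_(k < (n - j).+1) F j k (n - j - k)%N.
Proof.
pose G j k := F j (k - j)%N (n - k)%N.
transitivity (\sum_(0 <= k < n.+1) \sum_(0 <= j < n.+1 | (j <= k)%N) G j k).
  rewrite [RHS]big_mkord; apply: eq_bigr => k _.
  rewrite -(big_mkord xpredT (G ^~ k)) (big_nat_widen _ _ n.+1) ?ltn_ord //.
rewrite (exchange_big_dep_nat xpredT) //= big_mkord.
apply: eq_bigr => j _.
have lejn : (j <= n)%N by rewrite -ltnS.
transitivity (\sum_(j <= k < n.+1) G j k).
  rewrite [RHS]big_nat_cond [RHS](big_nat_widenl _ 0) //.
  rewrite big_nat_cond; apply: eq_bigl => k /=.
  by case: (j <= k)%N; rewrite /= ?andbF ?andbT.
rewrite -{1}[nat_of_ord j]add0n big_addn subSn // big_mkord.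
by apply: eq_bigr => k _; rewrite /G addnK addnC subnDA.
Qed.

Section PserRing.
Variable A : nzRingType.
Implicit Types x y z : pser A.

Definition pser_one : pser A := fun n => (n == 0)%N%:R.
Definition pser_mul x y : pser A := fun n => \sum_(k < n.+1) x k * y (n - k)%N.

Lemma pser_mulA : associative pser_mul.
Proof.
move=> x y z; apply/funext => n; rewrite /pser_mul.
under eq_bigr do rewrite mulr_sumr.
under [RHS]eq_bigr do rewrite mulr_suml.
rewrite (cauchy_exchange (fun a b c => x a * y b * z c)).
by do 2 (apply: eq_bigr => ? _); rewrite mulrA.
Qed.
Lemma pser_mul1 : left_id pser_one pser_mul.
Proof.
move=> x; apply/funext => n; rewrite /pser_mul big_ord_recl /= mul1r subn0.
by rewrite big1 ?addr0 // => k _; rewrite mul0r.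
Qed.
Lemma pser_mulr1 : right_id pser_one pser_mul.
Proof.
move=> x; apply/funext => n; rewrite /pser_mul big_ord_recr /= subnn mulr1.
rewrite big1 ?add0r // => k _; rewrite /pser_one subn_eq0 leqNgt ltn_ord.
by rewrite mulr0.
Qed.
Lemma pser_mulDl : left_distributive pser_mul +%R.
Proof.
move=> x y z; apply/funext => n; rewrite pserDE /pser_mul -big_split.
by apply: eq_bigr => k _; rewrite mulrDl.
Qed.
Lemma pser_mulDr : right_distributive pser_mul +%R.
Proof.
move=> x y z; apply/funext => n; rewrite pserDE /pser_mul -big_split.
by apply: eq_bigr => k _; rewrite mulrDr.
Qed.
Lemma pser_one_neq0 : pser_one != 0.
Proof.
by apply/eqP => /(congr1 (@^~ 0%N)) /eqP; rewrite /pser_one eqxx oner_eq0.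
Qed.

HB.instance Definition _ := GRing.Zmodule_isNzRing.Build (pser A)
  pser_mulA pser_mul1 pser_mulr1 pser_mulDl pser_mulDr pser_one_neq0.
End PserRing.

Section PserLmodule.
Variables (K : nzRingType) (V : lmodType K).
Implicit Types (c d : pser K) (x y : pser V).

Definition pser_scale c x : pser V :=
  fun n => \sum_(k < n.+1) c k *: x (n - k)%N.

Lemma pser_scaleA c d x : pser_scale c (pser_scale d x) = pser_scale (c * d) x.
Proof.
apply/funext => n; rewrite /pser_scale.
under eq_bigr do rewrite scaler_sumr.
under [RHS]eq_bigr do rewrite scaler_suml.
rewrite (cauchy_exchange (fun i j l => (c i * d j) *: x l)).
by do 2 (apply: eq_bigr => ? _); rewrite scalerA.
Qed.
Lemma pser_scale1 : left_id 1 pser_scale.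
Proof.
move=> x; apply/funext => n; rewrite /pser_scale big_ord_recl subn0.
by rewrite scale1r big1 ?addr0 // => k _; rewrite scale0r.
Qed.
Lemma pser_scaleDr : right_distributive pser_scale +%R.
Proof.
move=> c x y; apply/funext => n.
rewrite pserDE /pser_scale -big_split.
by apply: eq_bigr => k _; rewrite scalerDr.
Qed.
Lemma pser_scaleDl x : {morph pser_scale^~ x : c d / c + d}.
Proof.
move=> c d; apply/funext => n.
rewrite pserDE /pser_scale -big_split.
by apply: eq_bigr => k _; rewrite scalerDl.
Qed.

HB.instance Definition _ := GRing.Zmodule_isLmodule.Build (pser K) (pser V)
  pser_scaleA pser_scale1 pser_scaleDr pser_scaleDl.
End PserLmodule.

(* [hmon c n] is the monomial c h^n. *)
Definition hmon (K : nzRingType) (c : K) (n : nat) : pser K :=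
  fun m => if m == n then c else 0.

(* Sum of an h-adically summable family: in each degree in h only finitely
   many terms are nonzero. *)
Definition hsum (I : choiceType) (V : zmodType) (F : I -> pser V) : pser V :=
  fun n => \sum_(i \in [set: I]) F i n.

(* Closure in the h-adic topology. *)
Definition hclosure (V : Type) (S : set (pser V)) : set (pser V) :=
  [set x | forall n, exists2 y, S y & forall m, (m < n)%N -> x m = y m].

Definition linspan (S : nzRingType) (M : lmodType S) (B : set M) : set M :=
  [set v | exists2 s : seq (S * M), (forall x, x \in s -> B x.2)
                                  & v = \sum_(x <- s) x.1 *: x.2].

(* Generalized binomial coefficient x (x - 1) ... (x - k + 1) / k!. *)
Definition gbin (K : fieldType) (x : K) (k : nat) : K :=
  (\prod_(i < k) (x - i%:R)) / (k`!)%:R.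

(** * The double Yangian *)

(* Generators: [None] is C and [Some (i, j, r)] is t_{ij}^{(r)}, the indices
   1, 2 of the matrix entries being 0, 1 : 'I_2. *)
Definition ygen : choiceType := option ('I_2 * 'I_2 * int)%type.

(* h-adically completed free algebra K<C, t_{ij}^{(r)}>[[h]]. *)
Definition yfree (K : fieldType) := pser {malg K[{fmonom ygen}]}.

Section DoubleYangian.
Variable K : fieldType.
Local Notation yfree := (yfree K).

Definition ygenE (g : ygen) : yfree :=
  fun n => if n == 0%N then << fmu g >> else 0.
Definition yC : yfree := ygenE None.
Definition yt (i j : 'I_2) (r : int) : yfree := ygenE (Some (i, j, r)).

Local Notation h := (hmon (1 : K) 1).
Local Notation "a %:h" := (hmon (a : K) 0) (at level 2, format "a %:h").

(* Formal series in u with coefficients in the completed free algebra: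
   [f p] is the coefficient of u^p. *)
Definition useries := int -> yfree.

Definition uone : useries := fun p => if p == 0 then 1 else 0.
Definition uadd (f g : useries) : useries := fun p => f p + g p.
Definition usub (f g : useries) : useries := fun p => f p - g p.
Definition umul (f g : useries) : useries :=
  fun p => hsum (fun q : int => f q * g (p - q)).
Definition uexp (f : useries) (m : nat) : useries := iter m (umul f) uone.

(* Inverse of a series f congruent to 1 modulo h. *)
Definition uinv (f : useries) : useries :=
  fun p => hsum (fun m : nat => uexp (usub uone f) m p).

(* f(u + h c), expanded in nonnegative powers of h; c is central. *)
Definition ushift (c : yfree) (f : useries) : useries := fun p =>
  hsum (fun k : nat =>
    hmon (gbin (p + k%:Z)%:~R k) k *: (c ^+ k * f (p + k%:Z))).

(* h^{-1} f for a series f divisible by h. *)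
Definition udivh (f : useries) : useries := fun p n => f p n.+1.

Definition tplus (i j : 'I_2) : useries := fun p =>
  (if (i == j) && (p == 0) then 1 else 0)
  - (if p < 0 then h *: yt i j (- p - 1) else 0).
Definition tminus (i j : 'I_2) : useries := fun p =>
  (if (i == j) && (p == 0) then 1 else 0)
  + (if 0 <= p then h *: yt i j (- p - 1) else 0).

(* Boolean superscripts: [true] is +, [false] is -. *)
Definition tser (s : bool) := if s then tplus else tminus.

(** ** RTT relations *)

(* Coefficient of (h / w)^k in the entry of R(w) = (1 + h/w)^{-1} (1 + h/w P)
   at row (a, b) and column (c, d). *)
Definition Rentry (a b c d : 'I_2) (k : nat) : K :=
  ((a == c) && (b == d))%:R * (- 1) ^+ k
  + (if k is k'.+1 then ((a == d) && (b == c))%:R * (- 1) ^+ k' else 0).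

(* Coefficient of u^{-n-l} v^l in the entry of R(u - v + s h C).  One first
   expands in nonnegative powers of h, which leaves the terms
   h^n (u - v)^{-n}; then (u - v)^{-n} is expanded in nonnegative powers of v,
   the only expansion for which T^+(u) T^-(v) can be multiplied by it. *)
Definition Ruv (s : K) (a b c d : 'I_2) (nl : nat * nat) : yfree :=
  let: (n, l) := nl in
  hmon (gbin (- (n%:R)) l * (- 1) ^+ l) n *:
    (\sum_(k < n.+1)
       (Rentry a b c d k * gbin (- (k%:R)) (n - k) * s ^+ (n - k))%:h *:
       yC ^+ (n - k)).

(* Coefficients of u^p v^q in the entries at row (a, b) and column (k, l) of
     R_12(u - v + s h C) T_13(u) T_23(v)
   and
     T_23(v) T_13(u) R_12(u - v + s h C). *)
Definition RTT_left (s : K) (f g : 'I_2 -> 'I_2 -> useries)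
    (a b k l : 'I_2) (p q : int) : yfree :=
  \sum_(c : 'I_2) \sum_(d : 'I_2)
    hsum (fun nm : nat * nat => Ruv s a b c d nm *
      (f c k (p + (nm.1 + nm.2)%:Z) * g d l (q - nm.2%:Z))).
Definition RTT_right (s : K) (f g : 'I_2 -> 'I_2 -> useries)
    (a b k l : 'I_2) (p q : int) : yfree :=
  \sum_(c : 'I_2) \sum_(d : 'I_2)
    hsum (fun nm : nat * nat =>
      (g b d (q - nm.2%:Z) * f a c (p + (nm.1 + nm.2)%:Z)) *
      Ruv s c d k l nm).

Inductive dy_relator : yfree -> Prop :=
| dy_central g : dy_relator (yC * ygenE g - ygenE g * yC)
| dy_RTT (s : bool) a b k l p q :
    dy_relator (RTT_left 0 (tser s) (tser s) a b k l p q
                - RTT_right 0 (tser s) (tser s) a b k l p q)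
| dy_RTTpm a b k l p q :
    dy_relator (RTT_left (- 2%:R^-1) tplus tminus a b k l p q
                - RTT_right (2%:R^-1) tplus tminus a b k l p q).

Inductive dy_ideal0 : yfree -> Prop :=
| dy_ideal0_rel x : dy_relator x -> dy_ideal0 x
| dy_ideal0_zero : dy_ideal0 0
| dy_ideal0_add x y : dy_ideal0 x -> dy_ideal0 y -> dy_ideal0 (x + y)
| dy_ideal0_mul a x b : dy_ideal0 x -> dy_ideal0 (a * x * b).

(* DY(gl_2) is the quotient of [yfree] by this closed two-sided ideal. *)
Definition dy_ideal : set yfree := hclosure dy_ideal0.

(* A DY(gl_2)-module: a module over the K[[h]]-algebra [yfree] on which
   [dy_ideal] acts by zero. *)
Record DYgl2_module (M : lmodType (pser K)) (act : yfree -> M -> M) : Prop := {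
  act_addl : forall a b v, act (a + b) v = act a v + act b v;
  act_scalel : forall c a v, act (c *: a) v = c *: act a v;
  act_addr : forall a v w, act a (v + w) = act a v + act a w;
  act_scaler : forall c a v, act a (c *: v) = c *: act a v;
  act_one : forall v, act 1 v = v;
  act_mul : forall a b v, act (a * b) v = act a (act b v);
  act_ideal : forall a v, dy_ideal a -> act a v = 0
}.

(** ** The Drinfeld currents and DY(sl_2) *)

Definition k1 (s : bool) : useries := tser s 0 0.
Definition k2 (s : bool) : useries :=
  usub (tser s 1 1) (umul (umul (tser s 1 0) (uinv (tser s 0 0))) (tser s 0 1)).
Definition kser (j : 'I_2) := if j == 0 then k1 else k2.

Local Notation quarterC := ((4%:R^-1)%:h *: yC).

Definition Xplus : useries :=
  usub (umul (uinv (ushift (- quarterC) (tplus 0 0)))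
             (ushift (- quarterC) (tplus 0 1)))
       (umul (uinv (ushift quarterC (tminus 0 0)))
             (ushift quarterC (tminus 0 1))).
Definition Xminus : useries :=
  usub (umul (ushift quarterC (tplus 1 0))
             (uinv (ushift quarterC (tplus 0 0))))
       (umul (ushift (- quarterC) (tminus 1 0))
             (uinv (ushift (- quarterC) (tminus 0 0)))).

Definition Xalpha : useries := udivh Xplus.
Definition Xmalpha : useries := udivh Xminus.

Local Notation half := ((2%:R^-1)%:h *: (1 : yfree)).

Definition Eser : useries := ushift half Xalpha.
Definition Fser : useries := ushift half Xmalpha.
Definition Hser (s : bool) : useries :=
  umul (ushift half (k2 s)) (uinv (ushift half (k1 s))).

(* Preimage in [yfree] of the K[[h]]-subalgebra of DY(gl_2) generated by C and
   the coefficients of E, F, H^+ and H^-. *)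
Inductive dysl2_gen : yfree -> Prop :=
| dysl2_C : dysl2_gen yC
| dysl2_E p : dysl2_gen (Eser p)
| dysl2_F p : dysl2_gen (Fser p)
| dysl2_H s p : dysl2_gen (Hser s p)
| dysl2_ideal x : dy_ideal x -> dysl2_gen x
| dysl2_one : dysl2_gen 1
| dysl2_add x y : dysl2_gen x -> dysl2_gen y -> dysl2_gen (x + y)
| dysl2_scale c x : dysl2_gen x -> dysl2_gen (c *: x)
| dysl2_mul x y : dysl2_gen x -> dysl2_gen y -> dysl2_gen (x * y).

Definition DYsl2 : set yfree := hclosure dysl2_gen.

(* N is a K[[h]]-submodule of M stable under DY(sl_2), i.e. a DY(sl_2)-module
   for the restriction of [act]. *)
Record DYsl2_submodule (M : lmodType (pser K)) (act : yfree -> M -> M)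
    (N : set M) : Prop := {
  sub_zero : N 0;
  sub_add : forall v w, N v -> N w -> N (v + w);
  sub_scale : forall c v, N v -> N (c *: v);
  sub_act : forall a v, DYsl2 a -> N v -> N (act a v)
}.

End DoubleYangian.

(** * Fock spaces *)

(* Basis of U(s^-) (x) C[Q] e^{lambda_i}.  As s^- is abelian, U(s^-) is the
   polynomial algebra in the a_j(-r), r > 0: the monomial m has exponent
   [m (j, n)] at a_{j+1}(-(n+1)).  The integer k stands for e^{mu} with
   mu = lambda_i + k alpha. *)
Definition fbasis : choiceType := ({cmonom ('I_2 * nat)%type} * int)%type.

Definition fock0 (K : fieldType) := {malg K[fbasis]}.

(* The completed Fock space F_i.  Only the meaning of the basis depends
   on i. *)
Definition fock (K : fieldType) (i : 'I_2) := pser (fock0 K).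
Definition fock_lmod (K : fieldType) (i : 'I_2) : lmodType (pser K) := fock K i.

Section Fock.
Variable K : fieldType.
Local Notation fock0 := (fock0 K).

Definition flin (f : fbasis -> fock0) (v : fock0) : fock0 :=
  \sum_(b <- msupp v) v@_b *: f b.

Definition plift (i : 'I_2) (f : fock0 -> fock0) (v : fock K i) : fock K i :=
  fun n => f (v n).

(* a_j(r): multiplication for r < 0; for r > 0 the commutator with a_j(r),
   which is r times the derivative with respect to a_j(-r) since C = 1. *)
Definition heis (j : 'I_2) (r : int) : fock0 -> fock0 :=
  match r with
  | Negz n => flin (fun b => << (mmul (ucm (j, n)) b.1, b.2) >>)
  | Posz n.+1 => flin (fun b =>
      (n.+1 * b.1 (j, n))%:R *: << (divcm b.1 (ucm (j, n)), b.2) >>)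
  | Posz 0 => fun=> 0
  end.

(* e^{s alpha}. *)
Definition ealpha (i : 'I_2) (s : int) : fock K i -> fock K i :=
  plift (flin (fun b => << (b.1, b.2 + s) >>)).

(* e^{lambda_1} maps f (x) e^{k alpha} to f (x) e^{lambda_1 + k alpha}, which
   have the same coordinates. *)
Definition elambda1 (v : fock K 0) : fock K 1 := v.

Definition vac : fock K 0 :=
  fun n => if n == 0%N then << (onecm _, 0) >> else 0.

(* Eigenvalue (alpha/2, lambda_i + k alpha) of the derivation for alpha/2 on
   the basis vector of index k. *)
Definition halfalpha (i : 'I_2) (k : int) : K := k%:~R + (i : nat)%:R / 2%:R.

(** ** Operator-valued formal series in u *)

(* [A p v] is the coefficient of u^p in A(u) v. *)
Definition field (i : 'I_2) := int -> fock K i -> fock K i.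

Section Fields.
Variable i : 'I_2.
Local Notation field := (field i).

Definition fconst (T : fock K i -> fock K i) : field :=
  fun p v => if p == 0 then T v else 0.
Definition fadd (A B : field) : field := fun p v => A p v + B p v.
Definition fopp (A : field) : field := fun p v => - A p v.
Definition fmul (A B : field) : field :=
  fun p v => hsum (fun q : int => A (p - q) (B q v)).

(* A(u + a h), expanded in nonnegative powers of h. *)
Definition fshift (a : K) (A : field) : field := fun p v =>
  hsum (fun n : nat =>
    hmon (gbin (p + n%:Z)%:~R n * a ^+ n) n *: A (p + n%:Z) v).

Definition fexp (A : field) : field := fun p v =>
  hsum (fun n : nat =>
    hmon (n`!%:R^-1 : K) 0 *: iter n (fmul A) (fconst id) p v).

(* A(0), for a series A without negative powers of u. *)
Definition fat0 (A : field) : field := fconst (A 0).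

(* sum_{r>0} a_j(-r) / r u^r  and  sum_{r>0} a_j(r) / r u^{-r}. *)
Definition creat (j : 'I_2) : field := fun p v =>
  if p is Posz n.+1 then hmon (n.+1%:R^-1 : K) 0 *: plift (heis j (- p)) v
  else 0.
Definition annih (j : 'I_2) : field := fun p v =>
  if p is Negz n then hmon (n.+1%:R^-1 : K) 0 *: plift (heis j (- p)) v
  else 0.

(* The diagonal operator acting on the basis vectors of index k by
   u^(e k) (1 + a h/u)^(x k) (1 + b h/u)^(y k), so by
   (u + a h)^(x k) (u + b h)^(y k) when e k = x k + y k; the exponents x k
   and y k may be half-integers. *)
Definition fpow (e : int -> int) (a : K) (x : int -> K) (b : K) (y : int -> K) :
    field := fun p v =>
  hsum (fun n : nat => hmon (1 : K) n *: plift (flin (fun m =>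
    if p == e m.2 - n%:Z then
      (\sum_(l < n.+1) gbin (x m.2) l * a ^+ l
                       * (gbin (y m.2) (n - l) * b ^+ (n - l))) *: << m >>
    else 0)) v).

(** ** The level 1 action *)

Local Notation ha := (halfalpha i).
Local Notation mha := (fun k => - halfalpha i k).
(* 2 (alpha/2, mu) *)
Local Notation e2 := (fun k : int => (2%:Z * k + (i : nat)%:Z)).
Local Notation me2 := (fun k : int => - (2%:Z * k + (i : nat)%:Z)).

(* E^-(u) = exp Eminus_log(u); the inverse of an exponential is the
   exponential of the opposite. *)
Definition Eminus_log : field :=
  fadd (fopp (fshift (- (3%:R / 4%:R)) (creat 0)))
       (fshift (4%:R^-1) (creat 1)).
Definition Eminus : field := fexp Eminus_log.
Definition EminusV : field := fexp (fopp Eminus_log).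
Definition calE : field := fmul (fat0 EminusV) Eminus.
Definition calEV : field := fmul EminusV (fat0 Eminus).

Definition Eplus_log : field :=
  fshift (4%:R^-1) (fadd (annih 0) (fopp (annih 1))).
Definition Eplus : field := fexp Eplus_log.
Definition EplusV : field := fexp (fopp Eplus_log).

Definition Xalpha_op : field :=
  fmul calE (fmul Eplus (fmul (fconst (ealpha 1)) (fpow e2 0 ha 1 ha))).

Definition Xmalpha_op : field :=
  fmul (fshift (2%:R^-1) calEV)
    (fmul (fshift (- 2%:R^-1) EplusV)
      (fmul (fconst (ealpha (- 1)))
        (fpow me2 (- 2%:R^-1) mha (2%:R^-1) mha))).

(* c_j(u)^{alpha/2} *)
Definition cpow (j : 'I_2) : field :=
  fpow (fun=> 0) (4%:R^-1) ha
       (if j == 0 then 5%:R / 4%:R else - (3%:R / 4%:R)) mha.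

Definition kplus_op (j : 'I_2) : field :=
  fmul (fexp (fopp (fadd (fshift (2%:R^-1) (annih j))
                         (fopp (fshift (- 2%:R^-1) (annih j))))))
       (cpow j).

Definition kminus_op (j : 'I_2) : field :=
  if j == 0 then fexp (fadd (fshift 1 (creat 1)) (fopp (creat 1)))
  else fexp (fadd (creat 0) (fopp (fshift (- 1) (creat 0)))).

Definition kop (s : bool) : 'I_2 -> field := if s then kplus_op else kminus_op.

Record level1_action (act : yfree K -> fock K i -> fock K i) : Prop := {
  level1_module : DYgl2_module act;
  level1_C : forall v, act (yC K) v = v;
  level1_Xalpha : forall p v, act (Xalpha K p) v = Xalpha_op p v;
  level1_Xmalpha : forall p v, act (Xmalpha K p) v = Xmalpha_op p v;
  level1_k : forall s j p v, act (kser K j s p) v = kop s j p v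
}.

(* x(r), the coefficient of u^{-r-1} in X_alpha(u). *)
Definition xop (r : int) : fock K i -> fock K i := Xalpha_op (- r - 1).

End Fields.

(** ** The submodules L_0 and L_1 *)

(* x(r_n) ... x(r_1) 1, the sequence being [:: r_1; ...; r_n]. *)
Definition xmon (rs : seq int) : fock K 0 :=
  foldl (fun v r => xop r v) vac rs.

Definition BW0 : set (fock K 0) :=
  [set v | exists2 rs : seq int,
     (head (- 1) rs <= - 1) && sorted (fun r r' : int => r' <= r - 2) rs
     & v = xmon rs].

Definition L0_sl2 : set (fock K 0) :=
  hclosure (linspan [set w | exists k : int, exists2 b, BW0 b
                                                    & w = ealpha k b]).

Definition L1_sl2 : set (fock K 1) := elambda1 @` L0_sl2.

End Fock.

(* Main.v *)
From HB Require Import structures.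
From mathcomp Require Import all_boot all_order all_algebra.
From mathcomp Require Import finmap monalg complex.
From mathcomp Require Import boolp classical_sets fsbigop reals.
From mathcomp Require Import ring zify.
Require Import Defs.

Set Implicit Arguments.
Unset Strict Implicit.
Unset Printing Implicit Defensive.

Import GRing.Theory Num.Theory.
Local Open Scope ring_scope.

(** Write calE(u) = sum_l e_l u^l for the creation part of X_alpha(u), where
   e_0 = 1 and the e_l are multiplications by elements of the polynomial
   algebra of the creation operators, with coefficients in K[[h]]. Let N be
   the h-adic closure of the span of the vectors e_{l_1} ... e_{l_n} (x) e^{k
   alpha}. The theorem holds because L_0, hence L_1 in the same coordinates,
   is equal to N, and because N is visibly stable under E, F, H^+ and H^-.

   Stability. The derivation a_j(r), r > 0, maps the logarithm of calE(w) to a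
   scalar polynomial in w and h, homogeneous of degree r up to its value at w
   = 0; hence it maps e_l to a combination of the h^(r-m) e_{l-m} with m <= r
   (derS_ecoef). So every exponential of annihilation operators preserves N,
   and in degree -r it either lowers the indices by r in total or produces
   powers of h for what is missing (lowering). This gives the stability of N
   under X_alpha, X_{-alpha} and the k_j^+. The series k_j^- involve creation
   operators outside of the span of the e_l, but in k_2^-(u) k_1^-(u)^{-1}
   they combine into calE(u - h/4) calE(u + 3h/4)^{-1} (kminus_quotient).

   Equality with L_0. One inclusion follows from the stability. For the other
   one, X_alpha(u) maps the product of index l = (l_1, ..., l_n) in the sector
   n alpha to the sum over r of e_{x+r} times what remains after lowering l by
   r. So, modulo h, its coefficient numbered by x is the product of index
   (l_1, ..., l_n, x) plus products in which some units have been moved to the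
   last position (Xi_prod). Consequently the monomials x(r_n) ... x(r_1) 1
   with r_{j+1} <= r_j - 2 are, modulo h, unitriangular with respect to the
   products of weakly increasing index, for the order given by the sum of the
   partial sums of the index (xmon_lead), and by induction every product lies
   in their span modulo h N (prod_reached). The closure then absorbs all
   powers of h (L0_fockspan). *)

(** * Formal power series: sums, congruences, closed submodules *)

Definition eqh (V : Type) n (x y : pser V) := forall m, (m < n)%N -> x m = y m.

Definition hsummable (I : choiceType) (V : zmodType) (F : I -> pser V) :=
  forall n, exists r : seq I, forall i, i \notin r -> eqh n (F i) 0.

Section Summation.
Variables (I : choiceType) (V : zmodType).
Implicit Types F G : I -> pser V.

Lemma hsum_seq F n (r : seq I) : uniq r ->
  (forall i, i \notin r -> F i n = 0) -> hsum F n = \sum_(i <- r) F i n.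
Proof.
move=> ur hr; rewrite /hsum (fsbigE r _ ur) //; last by move=> i _ /hr.
by apply: eq_bigl => i; rewrite in_setT.
Qed.

Lemma hsum_undup F n (r : seq I) :
  (forall i, i \notin r -> F i n = 0) -> hsum F n = \sum_(i <- undup r) F i n.
Proof.
by move=> hr; apply: hsum_seq (undup_uniq r) _ => i; rewrite mem_undup => /hr.
Qed.

Lemma hsumD F G : hsummable F -> hsummable G ->
  hsum (fun i => F i + G i) = hsum F + hsum G.
Proof.
move=> sF sG; apply/funext => n.
have [r hr] := sF n.+1; have [s hs] := sG n.+1.
have [hr' hs'] : (forall i, i \notin r ++ s -> F i n = 0) /\
                 (forall i, i \notin r ++ s -> G i n = 0).
  by split=> i; rewrite mem_cat negb_or => /andP[/hr h1 /hs h2];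
    [apply: h1|apply: h2].
rewrite pserDE (hsum_undup hr') (hsum_undup hs') -big_split.
by apply: hsum_undup => i hi; rewrite pserDE hr' // hs' // addr0.
Qed.

Lemma hsum1 F i0 : (forall i, i != i0 -> F i = 0) -> hsum F = F i0.
Proof.
move=> h; apply/funext => n; rewrite (@hsum_seq _ _ [:: i0]) ?big_seq1 //.
by move=> i; rewrite inE => /h ->.
Qed.

Lemma hsum0 : hsum (fun _ : I => 0 : pser V) = 0.
Proof. by apply/funext => n; rewrite (@hsum_seq _ _ [::]) ?big_nil. Qed.

End Summation.

Lemma hsum_nat (V : zmodType) (F : nat -> pser V) n B :
  (forall k, (B <= k)%N -> F k n = 0) -> hsum F n = \sum_(k < B) F k n.
Proof.
move=> h; rewrite (@hsum_seq _ _ _ _ (iota 0 B)) ?iota_uniq //.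
  by rewrite -[in LHS](subn0 B) -/(index_iota 0 B) big_mkord.
by move=> k; rewrite mem_iota add0n leq0n /= -leqNgt => /h.
Qed.

Lemma hsum_up (V : zmodType) (F : int -> pser V) n (a : int) B :
  (forall q, F q n != 0 -> a <= q < a + B%:Z) ->
  hsum F n = \sum_(k < B) F (a + k%:Z) n.
Proof.
move=> h; rewrite (@hsum_seq _ _ _ _ [seq a + k%:Z | k <- iota 0 B]).
- by rewrite big_map -[in LHS](subn0 B) -/(index_iota 0 B) big_mkord.
- by rewrite map_inj_uniq ?iota_uniq // => x y /addrI [].
move=> q; apply: contraNeq => /h /andP[h1 h2]; apply/mapP.
by exists `|q - a|%N; [rewrite mem_iota; lia | lia].
Qed.

Lemma hsum_down (V : zmodType) (F : int -> pser V) n (a : int) B :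
  (forall q, F q n != 0 -> a - B%:Z < q <= a) ->
  hsum F n = \sum_(k < B) F (a - k%:Z) n.
Proof.
move=> h; rewrite (@hsum_seq _ _ _ _ [seq a - k%:Z | k <- iota 0 B]).
- by rewrite big_map -[in LHS](subn0 B) -/(index_iota 0 B) big_mkord.
- by rewrite map_inj_uniq ?iota_uniq // => x y /addrI /oppr_inj [].
move=> q; apply: contraNeq => /h /andP[h1 h2]; apply/mapP.
by exists `|a - q|%N; [rewrite mem_iota; lia | lia].
Qed.

Lemma pserNE (V : zmodType) (x : pser V) m : (- x) m = - x m. Proof. by []. Qed.
Lemma pser0E (V : zmodType) m : (0 : pser V) m = 0. Proof. by []. Qed.

Lemma pser_sumE (V : zmodType) (J : Type) (r : seq J) (P : pred J)
    (F : J -> pser V) m :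
  (\sum_(j <- r | P j) F j) m = \sum_(j <- r | P j) F j m.
Proof. by elim/big_rec2: _ => // j a b _ <-. Qed.

Section Congruence.
Variables (K : nzRingType) (V : lmodType K).
Implicit Types (x y : pser V) (c : pser K).

Lemma hmonZE (a : K) n x m :
  (hmon a n *: x) m = if (n <= m)%N then a *: x (m - n)%N else 0.
Proof.
rewrite /GRing.scale /= /pser_scale /hmon; case: ifP => [le_nm|].
  have hn : (n < m.+1)%N by [].
  rewrite (bigD1 (Ordinal hn)) //= eqxx big1 ?addr0 // => k.
  by rewrite -val_eqE /= => /negbTE ->; rewrite scale0r.
move=> /negbT; rewrite -ltnNge => hm; apply: big1 => k _.
by rewrite ifN ?scale0r //; have := ltn_ord k; lia.
Qed.

Lemma hmon0ZE (a : K) x m : (hmon a 0 *: x) m = a *: x m.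
Proof. by rewrite hmonZE leq0n subn0. Qed.

Lemma hmon1_0 : hmon (1 : K) 0 = 1.
Proof. by apply/funext => -[|n]. Qed.

Lemma pserZE c x n : (c *: x) n = \sum_(k < n.+1) c k *: x (n - k)%N.
Proof. by []. Qed.

Lemma eqh_trans n x y z : eqh n x y -> eqh n y z -> eqh n x z.
Proof. by move=> h1 h2 m hm; rewrite h1 // h2. Qed.

Lemma eqhD n x y x' y' : eqh n x x' -> eqh n y y' -> eqh n (x + y) (x' + y').
Proof. by move=> h h' m hm; rewrite !pserDE h ?h'. Qed.

Lemma eqhZ n c x y : eqh n x y -> eqh n (c *: x) (c *: y).
Proof.
move=> h m hm; rewrite !pserZE; apply: eq_bigr => k _.
by rewrite h // (leq_ltn_trans (leq_subr _ _)).
Qed.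

Lemma eqh_sum (J : Type) n (r : seq J) (P : pred J) (F G : J -> pser V) :
  (forall j, P j -> eqh n (F j) (G j)) ->
  eqh n (\sum_(j <- r | P j) F j) (\sum_(j <- r | P j) G j).
Proof.
move=> h; elim/big_rec2: _ => // j a b Pj hab.
exact: eqhD (h j Pj) hab.
Qed.

Lemma eqh_all x y : (forall n, eqh n x y) -> x = y.
Proof. by move=> h; apply/funext => n; apply: (h n.+1). Qed.

(** This description of a congruence is preserved by linear maps, which is why
   they are continuous. *)
Lemma eqh_div n x y : eqh n x y -> exists z, x = y + hmon 1 n *: z.
Proof.
move=> h; exists (fun m => (x - y) (m + n)%N); apply/funext => m.
rewrite pserDE hmonZE; case: leqP => hm; last by rewrite addr0 h.
by rewrite scale1r subnK // pserDE pserNE addrCA subrr addr0.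
Qed.

Lemma eqh_hmon n (a : K) x : eqh n (hmon a n *: x) 0.
Proof. by move=> m hm; rewrite hmonZE leqNgt hm. Qed.

Lemma hmonZZ (a b : K) m n x :
  hmon a m *: (hmon b n *: x) = hmon (a * b) (m + n) *: x.
Proof.
apply/funext => k; rewrite !hmonZE; case: leqP => h1; last first.
  by rewrite leqNgt (leq_trans h1 (leq_addr _ _)).
rewrite leq_subRL //; case: leqP => _; last by rewrite scaler0.
by rewrite scalerA subnDA.
Qed.

Lemma hsummable_hmon (a : nat -> K) (F : nat -> pser V) :
  hsummable (fun n => hmon (a n) n *: F n).
Proof.
move=> n; exists (iota 0 n) => k; rewrite mem_iota add0n leq0n /= -leqNgt.
by move=> hk m hm; rewrite hmonZE leqNgt (leq_trans hm hk).
Qed.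

Lemma hsum_hmonE (a : nat -> K) (F : nat -> pser V) n :
  hsum (fun k => hmon (a k) k *: F k) n
  = \sum_(k < n.+1) a k *: F k (n - k)%N.
Proof.
rewrite (@hsum_nat _ _ _ n.+1) => [|k hk]; last by rewrite hmonZE leqNgt hk.
by apply: eq_bigr => k _; rewrite hmonZE -ltnS ltn_ord.
Qed.

End Congruence.

(** ** Maps and subsets compatible with the h-adic topology *)

Section Linear.
Variables (K : nzRingType) (V W : lmodType K).

Definition hlin (f : pser V -> pser W) :=
  (forall x y, f (x + y) = f x + f y) /\
  (forall (c : pser K) x, f (c *: x) = c *: f x).

Variable f : pser V -> pser W.
Hypothesis lf : hlin f.

Lemma hlin0 : f 0 = 0.
Proof. by case: lf => _ hZ; rewrite -(scale0r 0) hZ scale0r. Qed.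

Lemma hlinN x : f (- x) = - f x.
Proof. by case: lf => _ hZ; rewrite -scaleN1r hZ scaleN1r. Qed.

Lemma hlin_sum (J : Type) (r : seq J) (P : pred J) (F : J -> pser V) :
  f (\sum_(j <- r | P j) F j) = \sum_(j <- r | P j) f (F j).
Proof.
case: (lf) => hD _; elim/big_rec2: _ => [|j a b _ <-]; first exact: hlin0.
by rewrite hD.
Qed.

Lemma hlin_eqh n x y : eqh n x y -> eqh n (f x) (f y).
Proof.
case: (lf) => hD hZ /eqh_div [z ->]; rewrite hD hZ -[X in eqh _ _ X]addr0.
by apply: eqhD => //; apply: eqh_hmon.
Qed.

Lemma hlin_summable (I : choiceType) (F : I -> pser V) :
  hsummable F -> f (hsum F) = hsum (fun i => f (F i)).
Proof.
move=> sF; apply/funext => n; have [r hr] := sF n.+1.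
have h0 i : i \notin r -> f (F i) n = 0.
  by move=> /hr /hlin_eqh /(_ n (ltnSn n)); rewrite hlin0.
rewrite (hsum_undup h0) -(@pser_sumE _ _ _ xpredT (fun i => f (F i))).
rewrite -hlin_sum.
apply: (@hlin_eqh n.+1) => // m hm; rewrite pser_sumE.
by apply: hsum_undup => i /hr /(_ m hm).
Qed.
End Linear.

Section Closed.
Variables (K : nzRingType) (V : lmodType K).

Record hclosed (N : set (pser V)) : Prop := {
  closed0 : N 0;
  closedD : forall x y, N x -> N y -> N (x + y);
  closedZ : forall (c : pser K) x, N x -> N (c *: x);
  closed_lim : forall x, (forall n, exists2 y, N y & eqh n x y) -> N x }.

Lemma closed_sum N (J : Type) (r : seq J) (P : pred J) (F : J -> pser V) :
  hclosed N ->
  (forall j, P j -> N (F j)) -> N (\sum_(j <- r | P j) F j).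
Proof.
by move=> hN hF; apply: big_ind => //; [apply: closed0|apply: closedD].
Qed.

Lemma closedN N x : hclosed N -> N x -> N (- x).
Proof. by move=> hN Nx; rewrite -scaleN1r; apply: closedZ. Qed.

Lemma closed_hsum N (I : choiceType) (F : I -> pser V) : hclosed N ->
  hsummable F -> (forall i, N (F i)) -> N (hsum F).
Proof.
move=> hN sF hF; apply: (closed_lim hN) => n; have [r hr] := sF n.
exists (\sum_(i <- undup r) F i); first exact: closed_sum.
by move=> m hm; rewrite pser_sumE; apply: hsum_undup => i /hr /(_ m hm).
Qed.

Lemma linspan0 (B : set (pser V)) : linspan B 0.
Proof. by exists [::]; rewrite ?big_nil. Qed.

Lemma linspanD (B : set (pser V)) x y :
  linspan B x -> linspan B y -> linspan B (x + y).
Proof.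
move=> [s hs ->] [t ht ->]; exists (s ++ t); last by rewrite big_cat.
by move=> z; rewrite mem_cat => /orP[/hs|/ht].
Qed.

Lemma linspanZ (B : set (pser V)) c x : linspan B x -> linspan B (c *: x).
Proof.
move=> [s hs ->]; exists [seq (c * z.1, z.2) | z <- s].
  by move=> z /mapP[w /hs ? ->].
by rewrite scaler_sumr big_map; apply: eq_bigr => z _; rewrite scalerA.
Qed.

Lemma linspan_gen (B : set (pser V)) x : B x -> linspan B x.
Proof.
move=> Bx; exists [:: (1, x)]; last by rewrite big_seq1 scale1r.
by move=> z; rewrite inE => /eqP ->.
Qed.

Lemma linspan_sub (B N : set (pser V)) :
  N 0 -> (forall x y, N x -> N y -> N (x + y)) ->
  (forall (c : pser K) x, N x -> N (c *: x)) ->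
  (forall x, B x -> N x) -> forall x, linspan B x -> N x.
Proof.
move=> n0 nD nZ hB x [s hs ->]; rewrite big_seq.
by apply: big_ind => // z /hs /hB; apply: nZ.
Qed.

Lemma hclosure_sub (A : set (pser V)) x : A x -> hclosure A x.
Proof. by move=> Ax n; exists x. Qed.

Lemma hclosed_span (B : set (pser V)) : hclosed (hclosure (linspan B)).
Proof.
split.
- exact/hclosure_sub/linspan0.
- move=> x y hx hy n; have [x' ? ?] := hx n; have [y' ? ?] := hy n.
  by exists (x' + y'); [apply: linspanD|apply: eqhD].
- move=> c x hx n; have [x' ? ?] := hx n.
  by exists (c *: x'); [apply: linspanZ|apply: eqhZ].
- move=> x hx n; have [y hy e] := hx n; have [z hz e'] := hy n.
  by exists z => // m hm; rewrite e // e'.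
Qed.

Lemma hclosure_span_gen (B : set (pser V)) x : B x -> hclosure (linspan B) x.
Proof. by move=> Bx; apply/hclosure_sub/linspan_gen. Qed.

Lemma hclosure_span_sub (B N : set (pser V)) : hclosed N ->
  (forall x, B x -> N x) -> forall x, hclosure (linspan B) x -> N x.
Proof.
move=> hN hB x hx; apply: (closed_lim hN) => n; have [y hy e] := hx n.
by exists y => //; case: hN => ? ? ? _; apply: (linspan_sub _ _ _ hB).
Qed.

End Closed.

(** A linear map is continuous, so that it can be tested on topological
   generators. *)
Lemma hlin_span (K : nzRingType) (V W : lmodType K) (f : pser V -> pser W)
  (B : set (pser V)) (N : set (pser W)) : hlin f -> hclosed N ->
  (forall x, B x -> N (f x)) -> forall x, hclosure (linspan B) x -> N (f x).
Proof.
move=> lf hN hB; apply: (@hclosure_span_sub _ _ B (fun x => N (f x))) => //.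
case: (lf) => fD fZ; split => [|x y|c x|x hx].
- by rewrite (hlin0 lf); apply: closed0.
- by rewrite fD; apply: closedD.
- by rewrite fZ; apply: closedZ.
- apply: (closed_lim hN) => n; have [y hy e] := hx n.
  by exists (f y) => //; apply: hlin_eqh.
Qed.

(** * Power series rings in one and two variables *)

Section PserComRing.
Variable A : comNzRingType.

Lemma pser_mulC : commutative (@pser_mul A).
Proof.
move=> x y; apply/funext => n.
rewrite /pser_mul.
rewrite [LHS](reindex_inj rev_ord_inj).
apply: eq_bigr => k _.
have -> : nat_of_ord (rev_ord k) = (n - k)%N by rewrite /= subSS.
have hk : (k <= n)%N by rewrite -ltnS.
by rewrite (subKn hk) mulrC.
Qed.

HB.instance Definition _ :=
  GRing.PzRing_hasCommutativeMul.Build (pser A) pser_mulC.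
End PserComRing.

Section PserRingTheory.
Variable A : nzRingType.
Implicit Types x y : pser A.

Lemma pserME x y n : (x * y) n = \sum_(k < n.+1) x k * y (n - k)%N.
Proof. by []. Qed.

Lemma pser1E n : (1 : pser A) n = (n == 0)%N%:R. Proof. by []. Qed.

Lemma hmonM (a : A) n x m :
  (hmon a n * x) m = if (n <= m)%N then a * x (m - n)%N else 0.
Proof.
rewrite pserME /hmon; case: ifP => [le_nm|].
  have hn : (n < m.+1)%N by [].
  rewrite (bigD1 (Ordinal hn)) //= eqxx big1 ?addr0 // => k.
  by rewrite -val_eqE /= => /negbTE ->; rewrite mul0r.
move=> /negbT; rewrite -ltnNge => hm; apply: big1 => k _.
by rewrite ifN ?mul0r //; have := ltn_ord k; lia.
Qed.

Lemma hmon0M (a : A) x m : (hmon a 0 * x) m = a * x m.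
Proof. by rewrite hmonM leq0n subn0. Qed.
End PserRingTheory.

Section PserAlg.
Variables (K : comNzRingType) (A : comAlgType K).

Lemma pser_scaleAl (c : pser K) (x y : pser A) : c *: (x * y) = (c *: x) * y.
Proof.
apply/funext => n; rewrite pserZE pserME.
under eq_bigr do rewrite scaler_sumr.
under [RHS]eq_bigr do rewrite pserZE mulr_suml.
rewrite (cauchy_exchange (fun i j l => (c i *: x j) * y l)).
by do 2 (apply: eq_bigr => ? _); rewrite scalerAl.
Qed.

Lemma pser_scaleAr (c : pser K) (x y : pser A) : c *: (x * y) = x * (c *: y).
Proof. by rewrite mulrC pser_scaleAl mulrC. Qed.

Lemma hlin_mull (x : pser A) : hlin (fun y : pser A => x * y : pser A).
Proof. by split=> [y z|c y]; rewrite ?mulrDr ?pser_scaleAr. Qed.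
End PserAlg.

(** The last sum is negligible when X n and Y n are of order at least n: this is
   how truncated exponentials and Taylor expansions are multiplied. *)
Lemma mul_partial_sums (A : nzRingType) (X Y : nat -> A) N :
  (\sum_(n < N) X n) * (\sum_(m < N) Y m) =
  \sum_(s < N) \sum_(k < s.+1) X k * Y (s - k)%N
  + \sum_(n < N) \sum_(m < N | (N <= n + m)%N) X n * Y m.
Proof.
rewrite mulr_suml; under eq_bigr do rewrite mulr_sumr.
have -> : \sum_(s < N) \sum_(k < s.+1) X k * Y (s - k)%N =
          \sum_(n < N) \sum_(m < N | ~~ (N <= n + m)%N) X n * Y m.
  case: N => [|N]; first by rewrite !big_ord0.
  under eq_bigr => s _.
    under eq_bigr => k _ do rewrite -[X k * _]mulr1.
    over.
  rewrite (cauchy_exchange (fun i j l => X i * Y j * 1)).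
  apply: eq_bigr => n _.
  have le_n : ((N - n).+1 <= N.+1)%N by rewrite ltnS leq_subr.
  rewrite (big_ord_widen _ (fun m => X n * Y m * 1) le_n).
  by apply: eq_big => [m|m _]; rewrite ?mulr1 //; have := ltn_ord n; lia.
rewrite -big_split; apply: eq_bigr => n _ /=.
by rewrite (bigID (fun m : 'I_N => (N <= n + m)%N)) /= addrC.
Qed.

(** * Exponentials and shifts of double series *)

Lemma pserMnE (V : zmodType) (x : pser V) m j : (x *+ m) j = x j *+ m.
Proof. by elim: m => [|m IH]; rewrite ?mulr0n // !mulrSr pserDE IH. Qed.

Lemma bin_trinomial p n m :
  ('C(p + n, n) * 'C(p + (n + m), m) = 'C(p + (n + m), n + m) * 'C(n + m, n))%N.
Proof.
have h1 : ('C(p + n, n) * (n`! * p`!) = (p + n)`!)%N.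
  by rewrite -{2}[p](addnK n) bin_fact // leq_addl.
have h2 : ('C(p + (n + m), m) * (m`! * (p + n)`!) = (p + (n + m))`!)%N.
  by rewrite addnA -{2}[(p + n)%N](addnK m) bin_fact // leq_addl.
have h3 : ('C(p + (n + m), n + m) * ((n + m)`! * p`!) = (p + (n + m))`!)%N.
  by rewrite -{2}[p](addnK (n + m)) bin_fact // leq_addl.
have h4 : ('C(n + m, n) * (n`! * m`!) = (n + m)`!)%N.
  by rewrite -{2}[m](addKn n) bin_fact // leq_addr.
apply/eqP; rewrite -(@eqn_pmul2r (n`! * m`! * p`!)); last first.
  by rewrite !muln_gt0 !fact_gt0.
apply/eqP; transitivity (p + (n + m))`!.
  by rewrite -h2 -h1; ring.
by rewrite -h3 -h4; ring.
Qed.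

Section DoubleSeries.
Variables (K : numFieldType) (A : comAlgType K).
Local Notation T := (pser (pser A)).
Implicit Types (f g x y : T).

(** Congruence modulo the n-th power of the ideal generated by the two
   variables. *)
Definition eqo n x y := forall p j, (p + j < n)%N -> x p j = y p j.

Lemma eqo_refl n x : eqo n x x. Proof. by []. Qed.
Lemma eqo_sym n x y : eqo n x y -> eqo n y x.
Proof. by move=> h p j /h. Qed.
Lemma eqo_trans n x y z : eqo n x y -> eqo n y z -> eqo n x z.
Proof. by move=> h1 h2 p j hp; rewrite h1 // h2. Qed.
Lemma eqo_leq m n x y : (m <= n)%N -> eqo n x y -> eqo m x y.
Proof. by move=> hm h p j hp; apply: h; apply: leq_trans hm. Qed.
Lemma eqo_all x y : (forall n, eqo n x y) -> x = y.
Proof.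
move=> h; apply/funext => p; apply/funext => j; apply: (h (p + j).+1).
exact: ltnSn.
Qed.

Lemma dserDE x y p j : (x + y) p j = x p j + y p j. Proof. by []. Qed.

Lemma dser_sumE (J : Type) (r : seq J) (P : pred J) (F : J -> T) p j :
  (\sum_(i <- r | P i) F i) p j = \sum_(i <- r | P i) F i p j.
Proof. by elim/big_rec2: _ => // i a b _ <-. Qed.

Lemma eqoD n x y x' y' : eqo n x x' -> eqo n y y' -> eqo n (x + y) (x' + y').
Proof. by move=> h h' p j hp; rewrite !dserDE h ?h'. Qed.

Lemma eqo_sum (J : Type) n (r : seq J) (P : pred J) (F G : J -> T) :
  (forall i, P i -> eqo n (F i) (G i)) ->
  eqo n (\sum_(i <- r | P i) F i) (\sum_(i <- r | P i) G i).
Proof.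
by move=> h; elim/big_rec2: _ => // i a b Pi hab; apply: eqoD (h i Pi) hab.
Qed.

Lemma eqo_sum0 (J : Type) n (r : seq J) (P : pred J) (F : J -> T) :
  (forall i, P i -> eqo n (F i) 0) -> eqo n (\sum_(i <- r | P i) F i) 0.
Proof.
move=> h; elim/big_rec: _ => // i a Pi ha; rewrite -[0]addr0.
exact: eqoD (h i Pi) ha.
Qed.

Lemma dserME x y p j : (x * y) p j =
  \sum_(a < p.+1) \sum_(c < j.+1) x a c * y (p - a)%N (j - c)%N.
Proof. by rewrite pserME pser_sumE; apply: eq_bigr => a _; rewrite pserME. Qed.

Lemma eqoM n x y x' y' : eqo n x x' -> eqo n y y' -> eqo n (x * y) (x' * y').
Proof.
move=> h h' p j hp; rewrite !dserME; apply: eq_bigr => a _.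
apply: eq_bigr => c _; have := ltn_ord a; have := ltn_ord c => ecoef ha.
by rewrite h ?h' //; lia.
Qed.

Lemma eqoM0 m n x y : eqo m x 0 -> eqo n y 0 -> eqo (m + n) (x * y) 0.
Proof.
move=> h h' p j hp; rewrite dserME big1 // => a _; rewrite big1 // => c _.
have := ltn_ord a; have := ltn_ord c => ecoef ha.
case: (ltnP (a + c) m) => hm; first by rewrite h // mul0r.
by rewrite h' ?mulr0 //; lia.
Qed.

Lemma eqoX n x : eqo 1 x 0 -> eqo n (x ^+ n) 0.
Proof.
move=> h; elim: n => [|n IH]; first by move=> p j.
by rewrite exprS; apply: eqoM0 h IH.
Qed.

(** ** The exponential *)

Definition dcst (c : K) : T := hmon (hmon (c%:A) 0) 0.

Lemma dcstM c x p j : (dcst c * x) p j = c *: x p j.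
Proof. by rewrite /dcst !hmon0M mulr_algl. Qed.

Lemma dcst_mul c d : dcst c * dcst d = dcst (c * d).
Proof.
apply/funext => p; apply/funext => j; rewrite dcstM /dcst /hmon.
case: p => [|p] /=; last by rewrite scaler0.
by case: j => [|j] /=; rewrite ?scaler0 ?scalerA.
Qed.

Lemma dcst_nat n : dcst n%:R = n%:R.
Proof.
apply/funext => p; apply/funext => j; rewrite !pserMnE /dcst /hmon.
case: p => [|p] /=; last by rewrite mul0rn.
by case: j => [|j] /=; rewrite ?mul0rn // scaler_nat.
Qed.

Definition expN N g : T := \sum_(n < N) dcst (n`!%:R^-1) * g ^+ n.
Definition expt g : T := fun p j => expN (p + j).+1 g p j.

(** The n-th term of the exponential has order at least n, so that a truncation
   determines the exponential up to a given order. *)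
Lemma eqo_expt N g : eqo 1 g 0 -> eqo N (expt g) (expN N g).
Proof.
move=> hg p j hp; rewrite /expt /expN !dser_sumE.
rewrite (big_ord_widen N (fun n => (dcst (n`!%:R^-1) * g ^+ n) p j)) //.
rewrite [RHS](bigID (fun n : 'I_N => (n < (p + j).+1)%N)) /=.
rewrite [X in _ = _ + X]big1 ?addr0 // => n; rewrite -leqNgt => hn.
by rewrite dcstM (eqoX hg) ?scaler0.
Qed.

Lemma exptD f g : eqo 1 f 0 -> eqo 1 g 0 -> expt (f + g) = expt f * expt g.
Proof.
move=> hf hg; apply: eqo_all => N.
have hfg : eqo 1 (f + g) 0 by rewrite -[0]addr0; apply: eqoD.
apply: eqo_trans (eqo_expt hfg) _; apply: eqo_sym.
apply: eqo_trans (eqoM (eqo_expt hf) (eqo_expt hg)) _.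
rewrite /expN (mul_partial_sums (fun n => dcst (n`!%:R^-1) * f ^+ n)
  (fun n => dcst (n`!%:R^-1) * g ^+ n)) -[X in eqo _ _ X]addr0.
apply: eqoD; last first.
  apply: eqo_sum0 => n _; apply: eqo_sum0 => m hm.
  apply: (@eqo_leq N (n + m)) => //.
  rewrite mulrACA; rewrite -[(n + m)%N]add0n.
  by apply: eqoM0; [move=> p j | apply: eqoM0; apply: eqoX].
apply: eqo_sum => s _; rewrite addrC exprDn mulr_sumr; move=> p j _.
congr (_ p j); apply: eq_bigr => k _.
have hk : (k <= s)%N by rewrite -ltnS.
rewrite mulrACA dcst_mul [g ^+ _ * _]mulrC -(mulr_natl (_ * _)) -dcst_nat.
rewrite [RHS]mulrA dcst_mul; congr (dcst _ * _).
have := bin_fact hk => /(congr1 (fun m : nat => m%:R : K)) h.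
have fn0 (m : nat) : (m`!%:R != 0 :> K) by rewrite pnatr_eq0 -lt0n fact_gt0.
rewrite -h !natrM; field.
by rewrite ?fn0 // pnatr_eq0 -lt0n bin_gt0.
Qed.

Lemma expt0 : expt 0 = 1.
Proof.
apply/funext => p; apply/funext => j; rewrite /expt /expN big_ord_recl.
rewrite big1 ?addr0 => [|i _]; last by rewrite exprS mul0r mulr0.
by rewrite fact0 invr1 expr0 mulr1 (dcst_nat 1).
Qed.

Lemma exptN f : eqo 1 f 0 -> expt f * expt (- f) = 1.
Proof.
move=> hf; rewrite -exptD ?subrr ?expt0 // => p j hp.
by rewrite pserNE pserNE hf ?oppr0.
Qed.

(** A derivation commutes with the truncations up to a loss of one degree. *)
Lemma expt_der (D : T -> T) g : eqo 1 g 0 ->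
  (forall x y, D (x + y) = D x + D y) ->
  (forall x y, D (x * y) = D x * y + x * D y) ->
  (forall c x, D (dcst c * x) = dcst c * D x) ->
  (forall n x, eqo n x 0 -> eqo n (D x) 0) ->
  D (expt g) = D g * expt g.
Proof.
move=> hg DD DM Dc Do; apply: eqo_all => N.
have D0 : D 0 = 0 by apply: (addIr (D 0)); rewrite -DD !add0r.
have D1 : D 1 = 0 by apply: (addIr (D 1)); rewrite add0r -{3}[1]mulr1 DM
  mulr1 mul1r.
have DN x : D (- x) = - D x by apply/eqP; rewrite -addr_eq0 -DD addNr D0.
have Deq n x y : eqo n x y -> eqo n (D x) (D y).
  move=> h; have : eqo n (D (x - y)) 0.
    by apply: Do => p j hp; rewrite dserDE h // !pserNE subrr.
  by rewrite DD DN => h' p j /h' /eqP; rewrite dserDE subr_eq0 => /eqP.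
have DX n : D (g ^+ n.+1) = D g * g ^+ n *+ n.+1.
  elim: n => [|n IH]; first by rewrite expr1 expr0 mulr1.
  rewrite exprS DM IH [in LHS]mulrnAr [_ *+ n.+2]mulrSr addrC exprS.
  by congr (_ *+ _ + _); rewrite mulrCA.
apply: eqo_trans (eqo_leq (leqnSn N) (Deq _ _ _ (eqo_expt hg))) _.
rewrite /expN big_ord_recl DD Dc D1 mulr0 add0r.
apply: eqo_trans (eqoM (eqo_refl _) (eqo_sym (eqo_expt hg))).
rewrite mulr_sumr (big_morph D DD D0) => p j _; congr (_ p j).
apply: eq_bigr => n _; rewrite Dc DX -(mulr_natl (D g * _)) -dcst_nat.
rewrite [LHS]mulrA dcst_mul [LHS]mulrCA; congr (_ * (dcst _ * _)).
rewrite factS natrM invfM mulrAC mulVf ?mul1r //.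
by rewrite pnatr_eq0.
Qed.

Lemma expt_morph (phi : T -> T) g : eqo 1 g 0 ->
  (forall x y, phi (x + y) = phi x + phi y) -> phi 1 = 1 ->
  (forall x y, phi (x * y) = phi x * phi y) ->
  (forall c x, phi (dcst c * x) = dcst c * phi x) ->
  (forall n x y, eqo n x y -> eqo n (phi x) (phi y)) ->
  phi (expt g) = expt (phi g).
Proof.
move=> hg pD p1 pM pc pe; apply: eqo_all => N.
have p0 : phi 0 = 0 by apply: (addIr (phi 0)); rewrite -pD !add0r.
have hpg : eqo 1 (phi g) 0 by rewrite -p0; apply: pe.
apply: eqo_trans (pe _ _ _ (eqo_expt hg)) _.
apply: eqo_trans (eqo_sym (eqo_expt hpg)).
rewrite /expN (big_morph phi pD p0) => p j _; congr (_ p j).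
have pX m : phi (g ^+ m) = phi g ^+ m.
  by elim: m => [|m IH]; rewrite ?expr0 // !exprS pM IH.
by apply: eq_bigr => n _; rewrite pc pX.
Qed.

(** ** The shift u -> u + a h *)

(** The coefficient of u^p in the expansion of f(u + a h) in powers of h, where
   the second index is the degree in h. *)
Definition dsh (a : K) g : T := fun p j =>
  \sum_(n < j.+1) a ^+ n *: (g (p + n)%N (j - n)%N *+ 'C(p + n, n)).

(** The divided derivative of order n in the outer variable. *)
Definition dder n g : T := fun p => g (p + n)%N *+ 'C(p + n, n).

Lemma sum_window (V : zmodType) (G : nat -> V) p k s : (k <= s)%N ->
  (forall i, (i < k)%N || (p + k < i <= p + s)%N -> G i = 0) ->
  \sum_(q < p.+1) G (q + k)%N = \sum_(i < (p + s).+1) G i.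
Proof.
move=> hks hG; rewrite -(big_mkord xpredT (fun q => G (q + k)%N)).
rewrite -(big_mkord xpredT G).
rewrite [RHS](@big_cat_nat _ _ _ k) //=; last by lia.
rewrite [X in _ + X](@big_cat_nat _ _ _ (p.+1 + k) k) //=; try lia.
rewrite [X in X + _]big_nat_cond [X in X + _]big1 ?add0r; last first.
  by move=> i hi; apply: hG; lia.
rewrite [X in _ + X]big_nat_cond [X in _ + X]big1 ?addr0; last first.
  by move=> i hi; apply: hG; lia.
by rewrite -{2}[k]add0n big_addn addnK.
Qed.

(** Leibniz rule; on coefficients it is the Vandermonde convolution. *)
Lemma dderM s f g : dder s (f * g) = \sum_(k < s.+1) dder k f * dder (s - k) g.
Proof.
apply/funext => p; rewrite pser_sumE /dder pserME.
pose H k i := f i * g (p + s - i)%N *+ ('C(i, k) * 'C(p + s - i, s - k)).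
transitivity (\sum_(k < s.+1) \sum_(i < (p + s).+1) H k i).
  rewrite exchange_big /= -sumrMnl; apply: eq_bigr => i _.
  have hi : (i <= p + s)%N by rewrite -ltnS.
  by rewrite /H sumrMnr binomial.Vandermonde subnKC.
apply: eq_bigr => k _; have hk : (k <= s)%N by rewrite -ltnS.
rewrite pserME -(@sum_window _ (H k) p k s hk) => [|i].
  apply: eq_bigr => q _; have hq : (q <= p)%N by rewrite -ltnS.
  have -> : (p - q + (s - k) = p + s - (q + k))%N by lia.
  by rewrite /H mulrnAl mulrnAr -mulrnA mulnC.
move=> hi; rewrite /H; case/orP: hi => hi; first by rewrite bin_small.
by rewrite [X in (_ * X)%N]bin_small ?muln0 //; lia.
Qed.

Definition dmon (a : K) n : T := hmon (hmon ((a ^+ n)%:A) n) 0.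

Lemma dmonM a n x p j :
  (dmon a n * x) p j = if (n <= j)%N then a ^+ n *: x p (j - n)%N else 0.
Proof. by rewrite /dmon hmon0M hmonM mulr_algl. Qed.

Lemma dmonD a m n x : dmon a m * (dmon a n * x) = dmon a (m + n) * x.
Proof.
apply/funext => p; apply/funext => j; rewrite !dmonM.
case: leqP => h1; last by rewrite leqNgt (leq_trans h1 (leq_addr _ _)).
rewrite leq_subRL //; case: leqP => _; last by rewrite scaler0.
by rewrite scalerA exprD subnDA.
Qed.

Lemma eqo_dsh N a g : eqo N (dsh a g) (\sum_(n < N) dmon a n * dder n g).
Proof.
move=> p j hp; rewrite dser_sumE /dsh.
have hj : (j.+1 <= N)%N by lia.
rewrite (big_ord_widen _ (fun n => a ^+ n *: (g (p + n)%N (j - n)%N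
  *+ 'C(p + n, n))) hj).
rewrite [RHS](bigID (fun n : 'I_N => (n < j.+1)%N)) /=.
rewrite [X in _ = _ + X]big1 ?addr0 => [|n]; last first.
  by rewrite dmonM ltnS => /negbTE ->.
by apply: eq_bigr => n; rewrite ltnS dmonM => ->; rewrite /dder pserMnE.
Qed.

(** Taylor expansion is a ring homomorphism, by the Leibniz rule for divided
   derivatives. *)
Lemma dshM a f g : dsh a (f * g) = dsh a f * dsh a g.
Proof.
apply: eqo_all => N; apply: eqo_trans (@eqo_dsh _ _ _) _; apply: eqo_sym.
apply: eqo_trans (eqoM (@eqo_dsh _ _ _) (@eqo_dsh _ _ _)) _.
rewrite (mul_partial_sums (fun n => dmon a n * dder n f)
  (fun n => dmon a n * dder n g)) -[X in eqo _ _ X]addr0.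
apply: eqoD; last first.
  apply: eqo_sum0 => n _; apply: eqo_sum0 => m hm.
  rewrite mulrACA -mulrA dmonD => p j hp.
  by rewrite dmonM ifN //; lia.
apply: eqo_sum => s _; rewrite dderM mulr_sumr => p j _; congr (_ p j).
apply: eq_bigr => k _; have hk : (k <= s)%N by rewrite -ltnS.
by rewrite mulrACA -mulrA dmonD subnKC.
Qed.

Lemma dshD a f g : dsh a (f + g) = dsh a f + dsh a g.
Proof.
apply/funext => p; apply/funext => j; rewrite dserDE /dsh -big_split.
by apply: eq_bigr => n _; rewrite dserDE mulrnDl scalerDr.
Qed.

Lemma dshN a f : dsh a (- f) = - dsh a f.
Proof.
apply/funext => p; apply/funext => j; rewrite !pserNE /dsh -sumrN.
by apply: eq_bigr => n _; rewrite !pserNE mulNrn scalerN.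
Qed.

Lemma dsh_cst a (s : pser A) : dsh a (hmon s 0) = hmon s 0.
Proof.
apply/funext => p; apply/funext => j; rewrite /dsh big_ord_recl expr0 scale1r.
rewrite addn0 bin0 mulr1n subn0 big1 ?addr0 // => i _.
by rewrite /hmon addnS /= mul0rn scaler0.
Qed.

Lemma dsh1 a : dsh a 1 = 1.
Proof.
have -> : (1 : T) = hmon 1 0 by apply/funext => -[|p].
exact: dsh_cst.
Qed.

Lemma dsh_dcst a c x : dsh a (dcst c * x) = dcst c * dsh a x.
Proof. by rewrite dshM /dcst dsh_cst. Qed.

Lemma dsh_eqo a n x y : eqo n x y -> eqo n (dsh a x) (dsh a y).
Proof.
move=> h p j hp; apply: eq_bigr => k _; congr (_ *: (_ *+ _)).
by apply: h; have := ltn_ord k; lia.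
Qed.

Lemma dsh_expt a g : eqo 1 g 0 -> dsh a (expt g) = expt (dsh a g).
Proof.
move=> hg; apply: expt_morph => //; first exact: dshD; first exact: dsh1.
- exact: dshM.
- exact: dsh_dcst.
- exact: dsh_eqo.
Qed.

Lemma dsh_dsh a b g : dsh a (dsh b g) = dsh (a + b) g.
Proof.
apply/funext => p; apply/funext => j; rewrite /dsh.
pose F n m l := (a ^+ n * b ^+ m) *:
  (g (p + (n + m))%N l *+ ('C(p + n, n) * 'C(p + (n + m), m))).
transitivity (\sum_(n < j.+1) \sum_(m < (j - n).+1) F n m (j - n - m)%N).
  apply: eq_bigr => n _; rewrite -sumrMnl scaler_sumr; apply: eq_bigr => m _.
  by rewrite /F !scalerMnr scalerA -mulrnA addnA mulnC.
rewrite -cauchy_exchange; apply: eq_bigr => s _.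
transitivity (\sum_(k < s.+1) (a ^+ k * b ^+ (s - k) *+ 'C(s, k)) *:
  (g (p + s)%N (j - s)%N *+ 'C(p + s, s))).
  apply: eq_bigr => k _; have hk : (k <= s)%N by rewrite -ltnS.
  rewrite /F subnKC //; have := bin_trinomial p k (s - k).
  by rewrite subnKC // => ->; rewrite mulrnA -scalerMnr scalerMnl.
rewrite -scaler_suml; congr (_ *: _).
by rewrite addrC exprDn; apply: eq_bigr => k _; rewrite mulrC.
Qed.

End DoubleSeries.

(** * Fields on Fock space that preserve the polynomial part *)

HB.lock Definition lext (K : comNzRingType) (M : choiceType) (W : lmodType K)
    (f : M -> W) (v : {malg K[M]}) : W :=
  \sum_(b <- msupp v) v@_b *: f b.

Section LinearExtension.
Variables (K : comNzRingType) (M : choiceType) (W : lmodType K) (f : M -> W).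
Local Notation lext := (lext f).

Lemma lextEw (d : {fset M}) v : (msupp v `<=` d)%fset ->
  lext v = \sum_(b <- d) v@_b *: f b.
Proof.
move=> le; rewrite unlock (big_fset_incl _ le) => //= x xd /mcoeff_outdom ->.
by rewrite scale0r.
Qed.

Lemma lextD x y : lext (x + y) = lext x + lext y.
Proof.
pose d := (msupp x `|` msupp y)%fset.
rewrite (@lextEw d) ?msuppD_le // (@lextEw d x) ?fsubsetUl //.
rewrite (@lextEw d y) ?fsubsetUr // -big_split; apply: eq_bigr => b _ /=.
by rewrite mcoeffD scalerDl.
Qed.

Lemma lextZ c x : lext (c *: x) = c *: lext x.
Proof.
rewrite !(@lextEw (msupp x)) ?msuppZ_le // scaler_sumr.
by apply: eq_bigr => b _; rewrite mcoeffZ scalerA.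
Qed.

Lemma lextU b : lext << b >> = f b.
Proof. by rewrite (lextEw msuppU_le) big_seq_fset1 mcoeffUU scale1r. Qed.
End LinearExtension.

Definition klin (K : nzRingType) (V W : lmodType K) (f : V -> W) :=
  (forall x y, f (x + y) = f x + f y) /\ (forall c x, f (c *: x) = c *: f x).

Lemma klin_lext (K : comNzRingType) (M : choiceType) (W : lmodType K)
  (f : M -> W) : klin (lext f).
Proof. by split; [apply: lextD|apply: lextZ]. Qed.

Lemma malg_eq_lin (K : comNzRingType) (M : choiceType) (W : lmodType K)
  (f g : {malg K[M]} -> W) : klin f -> klin g ->
  (forall b, f << b >> = g << b >>) -> f =1 g.
Proof.
move=> [fD fZ] [gD gZ] h x; rewrite (monalgE x).
have f0 : f 0 = 0 by rewrite -(scale0r 0) fZ scale0r.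
have g0 : g 0 = 0 by rewrite -(scale0r 0) gZ scale0r.
rewrite (big_morph f fD f0) (big_morph g gD g0); apply: eq_bigr => b _.
have -> : << x@_b *g b >> = x@_b *: (<< b >> : {malg K[M]}).
  by apply/malgP => c; rewrite mcoeffZ !mcoeffU mulrnAr mulr1.
by rewrite fZ gZ h.
Qed.

Lemma hlin_map (K : nzRingType) (V W : lmodType K) (f : V -> W) :
  klin f -> hlin (fun (x : pser V) n => f (x n)).
Proof.
move=> [fD fZ]; split=> [x y|c x]; apply/funext => n; first by rewrite !pserDE.
have f0 : f 0 = 0 by rewrite -(scale0r 0) fZ scale0r.
by rewrite !pserZE (big_morph f fD f0); apply: eq_bigr => k _.
Qed.

Lemma hlin_comp (K : nzRingType) (U V W : lmodType K)
  (f : pser V -> pser W) (g : pser U -> pser V) :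
  hlin f -> hlin g -> hlin (fun x => f (g x)).
Proof. by move=> [fD fZ] [gD gZ]; split=> *; rewrite ?gD ?gZ ?fD ?fZ. Qed.

Section KLinear.
Variables (K : comNzRingType) (U V W : lmodType K) (A : comAlgType K).

Lemma klin_comp (f : V -> W) (g : U -> V) :
  klin f -> klin g -> klin (fun x => f (g x)).
Proof. by move=> [fD fZ] [gD gZ]; split=> *; rewrite ?gD ?gZ ?fD ?fZ. Qed.

Lemma klin_add (f g : V -> W) : klin f -> klin g -> klin (fun x => f x + g x).
Proof.
move=> [fD fZ] [gD gZ]; split=> [x y|c x]; first by rewrite fD gD addrACA.
by rewrite fZ gZ scalerDr.
Qed.

Lemma klin_scale (c : K) : klin (fun x : V => c *: x).
Proof.
split=> [x y|d x]; first exact: scalerDr.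
by rewrite !scalerA mulrC.
Qed.

Lemma klin_mull (a : A) : klin (fun x : A => a * x).
Proof. by split=> [x y|c x]; rewrite ?mulrDr ?scalerAr. Qed.

Lemma klin_mulr (a : A) : klin (fun x : A => x * a).
Proof. by split=> [x y|c x]; rewrite ?mulrDl ?scalerAl. Qed.
End KLinear.

Section Fock.
Variable K : numFieldType.
Local Notation J := ('I_2 * nat)%type.
Local Notation R0 := {malg K[{cmonom J}]}.
Local Notation fock0 := (fock0 K).

(** The map f |-> f (x) e^{lambda_i + k alpha}. *)
Definition sector0 (k : int) : R0 -> fock0 :=
  lext (fun m => << (m, k) >> : fock0).
Lemma klin_sector0 k : klin (sector0 k). Proof. exact: klin_lext. Qed.

Lemma sector0_inj k : injective (sector0 k).
Proof.
pose g : fock0 -> R0 := lext (fun b => << b.1 >> : R0).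
apply: (can_inj (g := g)).
apply: (@malg_eq_lin _ _ _ (fun x => g (sector0 k x)) id) => //.
  exact: klin_comp (klin_lext _) (klin_sector0 k).
by move=> b; rewrite /sector0 /g !lextU.
Qed.

Lemma flinE (f : fbasis -> fock0) : flin f = lext f.
Proof. by rewrite [@lext]unlock. Qed.

Lemma flinU (f : fbasis -> fock0) b : flin f << b >> = f b.
Proof. by rewrite flinE lextU. Qed.

Lemma klin_heis j r : klin (@heis K j r).
Proof.
case: r => [[|n]|n]; first by split=> *; rewrite /= ?addr0 ?scaler0.
  by rewrite /heis flinE; apply: klin_lext.
by rewrite /heis flinE; apply: klin_lext.
Qed.

Definition xvar (j : 'I_2) (n : nat) : R0 := << ucm (j, n) >>.

Lemma sector_creat k j n (f : R0) :
  heis j (Negz n) (sector0 k f) = sector0 k (xvar j n * f).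
Proof.
apply: (@malg_eq_lin _ _ _ (fun f => heis j (Negz n) (sector0 k f))
  (fun f => sector0 k (xvar j n * f))).
- exact: klin_comp (klin_heis _ _) (klin_sector0 k).
- exact: klin_comp (klin_sector0 k) (klin_mull _).
move=> m; rewrite /sector0 lextU /heis flinU /xvar.
by rewrite malgM_def fgmulUU mulr1 lextU.
Qed.

(** The partial derivative with respect to a_{j+1}(-(n+1)). *)
Definition der (j : 'I_2) (n : nat) : R0 -> R0 :=
  lext (fun m : {cmonom J} => (m (j, n))%:R *: << divcm m (ucm (j, n)) >> : R0).

Lemma klin_der j n : klin (der j n). Proof. exact: klin_lext. Qed.

Lemma sector_annih k j n (f : R0) :
  heis j (Posz n.+1) (sector0 k f) = sector0 k (n.+1%:R *: der j n f).
Proof.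
apply: (@malg_eq_lin _ _ _ (fun f => heis j (Posz n.+1) (sector0 k f))
  (fun f => sector0 k (n.+1%:R *: der j n f))).
- exact: klin_comp (klin_heis _ _) (klin_sector0 k).
- apply: klin_comp (klin_sector0 k) _.
  exact: (klin_comp (klin_scale _ n.+1%:R) (klin_der j n)).
move=> m; rewrite /sector0 lextU /heis flinU /der lextU.
by rewrite !lextZ lextU scalerA natrM.
Qed.

Lemma der_mul j n f g : der j n (f * g) = der j n f * g + f * der j n g.
Proof.
have hd := klin_der j n.
move: g; apply: malg_eq_lin.
- exact: klin_comp hd (klin_mull f).
- exact: klin_add (klin_mull _) (klin_comp (klin_mull f) hd).
move=> m'; move: f; apply: malg_eq_lin.
- exact: klin_comp hd (klin_mulr _).
- exact: klin_add (klin_comp (klin_mulr _) hd) (klin_mulr _).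
move=> m; set u := ucm (j, n).
have E (a b : {cmonom J}) : << a >> * << b >> = << mmul a b >> :> R0.
  by rewrite malgM_def fgmulUU mulr1.
have dU (a : {cmonom J}) : der j n << a >> = (a (j, n))%:R *: << divcm a u >>.
  exact: lextU.
have key (a b : {cmonom J}) : (a (j, n))%:R *: << divcm (mmul a b) u >>
    = (a (j, n))%:R *: << mmul (divcm a u) b >> :> R0.
  have [->|a0] := eqVneq (a (j, n)) 0%N.
    exact: etrans (scale0r _) (esym (scale0r _)).
  apply: (congr1 (fun z => _ *: << z >>)).
  apply/eqP/cmP => i; rewrite cmM !divcmE cmM ucmE.
  case: eqP => [<-|_]; last by rewrite !subn0.
  by rewrite addnBAC // lt0n.
have mC (a b : {cmonom J}) : mmul a b = mmul b a.
  by apply/eqP/cmP => i; rewrite !cmM addnC.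
apply: etrans (congr1 (der j n) (E m m')) _; apply: etrans (dU _) _.
have -> : (mmul m m') (j, n) = (m (j, n) + m' (j, n))%N by rewrite cmM.
apply: etrans (congr1 (fun c => c *: _) (natrD _ _ _)) _.
apply: etrans (scalerDl _ _ _) _; apply: f_equal2.
  apply: etrans (key m m') _; apply: esym.
  apply: etrans (congr1 (fun z => z * << m' >>) (dU m)) _.
  apply: etrans (esym (scalerAl _ _ _)) _.
  exact: (congr1 (fun z => _ *: z) (E _ _)).
apply: etrans (congr1 (fun z => _ *: << divcm z u >>) (mC m m')) _.
apply: etrans (key m' m) _; apply: esym.
apply: etrans (congr1 (fun z => << m >> * z) (dU m')) _.
apply: etrans (esym (scalerAr _ _ _)) _.
apply: etrans (congr1 (fun z => _ *: z) (E _ _)) _.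
exact: (congr1 (fun z => _ *: << z >>) (mC _ _)).
Qed.

Lemma der_xvar j n j' n' : der j n (xvar j' n') = ((j', n') == (j, n))%:R.
Proof.
rewrite /der lextU ucmE; case: eqP => [[-> ->]|_]; last by rewrite scale0r.
rewrite scale1r; congr << _ >>; apply/eqP/cmP => i.
by rewrite divcmE subnn cm1.
Qed.

Lemma sector0_one : sector0 0 1 = << (onecm _, 0) >>.
Proof. exact: lextU. Qed.

Lemma sector_shift k s (f : R0) :
  flin (fun b => << (b.1, b.2 + s) >>) (sector0 k f) = sector0 (k + s) f.
Proof.
move: f; apply: malg_eq_lin.
- by rewrite flinE; apply: klin_comp (klin_lext _) (klin_sector0 k).
- exact: klin_sector0.
- move=> m; apply: etrans (congr1 (flin _) (lextU _ m)) _.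
  by apply: etrans (flinU _ _) _; apply: esym; apply: lextU.
Qed.

Lemma sector_diag (c : int -> K) k (f : R0) :
  flin (fun b => c b.2 *: << b >>) (sector0 k f) = c k *: sector0 k f.
Proof.
move: f; apply: malg_eq_lin.
- by rewrite flinE; apply: klin_comp (klin_lext _) (klin_sector0 k).
- exact: klin_comp (klin_scale _ _) (klin_sector0 k).
- move=> m; apply: etrans (congr1 (flin _) (lextU _ m)) _.
  apply: etrans (flinU _ _) _; apply: (congr1 (fun z => c k *: z)).
  by apply: esym; apply: lextU.
Qed.

End Fock.

(** Fock space as copies of one commutative algebra A, the polynomials in the
   creation operators, indexed by the elements of Q.  The polynomial algebra
   enters what follows only through its generators and its partial derivatives,
   so that it can be kept abstract. *)
Record fock_model (K : numFieldType) := FockModel {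
  fm_alg : comAlgType K;
  fm_sec : int -> fm_alg -> fock0 K;
  fm_var : 'I_2 -> nat -> fm_alg;
  fm_der : 'I_2 -> nat -> fm_alg -> fm_alg;
  fm_sec_lin : forall k, klin (fm_sec k);
  fm_sec_inj : forall k, injective (fm_sec k);
  fm_sec_one : fm_sec 0 1 = << (onecm _, 0) >>;
  fm_shift : forall k s f,
    flin (fun b => << (b.1, b.2 + s) >>) (fm_sec k f) = fm_sec (k + s) f;
  fm_diag : forall (c : int -> K) k f,
    flin (fun b => c b.2 *: << b >>) (fm_sec k f) = c k *: fm_sec k f;
  fm_creat : forall k j n f,
    heis j (Negz n) (fm_sec k f) = fm_sec k (fm_var j n * f);
  fm_annih : forall k j n f,
    heis j (Posz n.+1) (fm_sec k f) = fm_sec k (n.+1%:R *: fm_der j n f);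
  fm_der_lin : forall j n, klin (fm_der j n);
  fm_der_mul : forall j n f g,
    fm_der j n (f * g) = fm_der j n f * g + f * fm_der j n g;
  fm_der_var : forall j n j' n',
    fm_der j n (fm_var j' n') = ((j', n') == (j, n))%:R }.

Definition polynomial_fock (K : numFieldType) : fock_model K.
Proof.
exact: (FockModel (@klin_sector0 K) (@sector0_inj K) (@sector0_one K)
  (@sector_shift K) (@sector_diag K) (@sector_creat K) (@sector_annih K)
  (@klin_der K) (@der_mul K) (@der_xvar K)).
Qed.

Lemma gbin_nat (K : numFieldType) m n : gbin (m%:R : K) n = 'C(m, n)%:R.
Proof.
have h : \prod_(i < n) (m%:R - i%:R : K) = (m ^_ n)%:R.
  elim: n => [|n IH]; first by rewrite big_ord0 ffactn0.
  rewrite big_ord_recr IH ffactnSr natrM /=.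
  case: (leqP n m) => hn; first by rewrite natrB.
  by rewrite ffact_small // !mul0r.
rewrite /gbin h -bin_ffact natrM mulfK //.
by rewrite pnatr_eq0 -lt0n fact_gt0.
Qed.

Section Sectors.
Variables (K : numFieldType) (M : fock_model K).
Local Notation A := (fm_alg M).
Local Notation S := (pser A).
Local Notation T := (pser (pser A)).
Implicit Types (s t : S) (f g : T) (k p : int).

Definition sec k s : pser (fock0 K) := fun n => fm_sec k (s n).

Lemma hlin_sec k : hlin (sec k).
Proof. exact: hlin_map (fm_sec_lin M k). Qed.

Lemma secD k s t : sec k (s + t) = sec k s + sec k t.
Proof. exact: (hlin_sec k).1. Qed.
Lemma secZ k c s : sec k (c *: s) = c *: sec k s.
Proof. exact: (hlin_sec k).2. Qed.
Lemma sec0 k : sec k 0 = 0. Proof. exact: hlin0 (hlin_sec k). Qed.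
Lemma secN k s : sec k (- s) = - sec k s.
Proof. exact: hlinN (hlin_sec k) _. Qed.
Lemma sec_sum k (I : Type) (r : seq I) (P : pred I) (F : I -> S) :
  sec k (\sum_(i <- r | P i) F i) = \sum_(i <- r | P i) sec k (F i).
Proof. exact: (hlin_sum (hlin_sec k)). Qed.

Definition zcoef f p : S := if p is Posz n then f n else 0.

Lemma zcoefD f g p : zcoef (f + g) p = zcoef f p + zcoef g p.
Proof. by case: p => n //=; rewrite addr0. Qed.
Lemma zcoefN f p : zcoef (- f) p = - zcoef f p.
Proof. by case: p => n //=; rewrite oppr0. Qed.

(** ** Fields of creation type *)

Section Multiplication.
Variable i : 'I_2.
Local Notation field := (field K i).
Implicit Types (F G : field).

(** Fields built from creation operators only, which can be computed in the ring
   T of series instead of on Fock space. *)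
Definition mulfield F f := forall p k s, F p (sec k s) = sec k (zcoef f p * s).

Lemma mulfield_add F G f g :
  mulfield F f -> mulfield G g -> mulfield (fadd F G) (f + g).
Proof. by move=> hF hG p k s; rewrite /fadd hF hG -secD -mulrDl zcoefD. Qed.

Lemma mulfield_opp F f : mulfield F f -> mulfield (fopp F) (- f).
Proof. by move=> hF p k s; rewrite /fopp hF -secN -mulNr zcoefN. Qed.

Lemma mulfield_const (c : S) (L : fock K i -> fock K i) :
  (forall k s, L (sec k s) = sec k (c * s)) -> mulfield (fconst L) (hmon c 0).
Proof.
move=> hL p k s; rewrite /fconst; case: eqP => [->|p0]; first by rewrite hL.
case: p p0 => [[|n]|n] // _; rewrite /zcoef /hmon /= mul0r sec0 //.
Qed.

Lemma mulfield_mul F G f g :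
  mulfield F f -> mulfield G g -> mulfield (fmul F G) (f * g).
Proof.
move=> hF hG p k s; rewrite /fmul; case: p => p; last first.
  have -> : (fun q => F (Negz p - q) (G q (sec k s))) = fun=> 0.
    apply/funext => q; rewrite hG hF; case: q => q /=.
      have -> : Negz p - Posz q = Negz (p + q) by lia.
      by rewrite /= mul0r sec0.
    by rewrite mul0r mulr0 sec0.
  by rewrite hsum0 /= mul0r sec0.
apply/funext => m; rewrite (@hsum_up _ _ _ 0 p.+1) => [|q]; last first.
  rewrite hG hF; apply: contra_neqT => hq.
  case: q hq => q hq /=; last by rewrite mul0r mulr0 sec0.
  have -> : Posz p - Posz q = Negz (q - p).-1 by lia.
  by rewrite /= mul0r sec0.
rewrite [zcoef _ _]pserME mulr_suml sec_sum pser_sumE (reindex_inj rev_ord_inj).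
apply: eq_bigr => q _; rewrite add0r hG hF /=.
have hq : (q <= p)%N by rewrite -ltnS.
have -> : Posz p - Posz (p.+1 - q.+1)%N = Posz q by lia.
by rewrite subSS mulrA.
Qed.

Lemma mulfield_iter F f n :
  mulfield F f -> mulfield (iter n (fmul F) (fconst id)) (f ^+ n).
Proof.
move=> hF; elim: n => [|n IH]; last by rewrite exprS; apply: mulfield_mul.
rewrite expr0; have -> : (1 : T) = hmon 1 0 by apply/funext => -[|n].
by apply: mulfield_const => k s; rewrite mul1r.
Qed.

(** The n-th power of the logarithm contributes only in total degree at least n,
   so that the exponential series is finite in each degree. *)
Lemma mulfield_exp F f : eqo 1 f 0 ->
  mulfield F f -> mulfield (fexp F) (expt f).
Proof.
move=> hf hF p k s; rewrite /fexp.
have -> : (fun n => hmon (n`!%:R^-1 : K) 0 *: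
             iter n (fmul F) (fconst id) p (sec k s))
        = fun n => sec k (hmon (n`!%:R^-1 : K) 0 *: (zcoef (f ^+ n) p * s)).
  by apply/funext => n; rewrite (mulfield_iter n hF) secZ.
case: p => p /=; last first.
  rewrite mul0r sec0 -[RHS](@hsum0 nat); congr hsum; apply/funext => n.
  by rewrite scaler0 sec0.
rewrite -(hlin_summable (hlin_sec k)); last first.
  move=> n; exists (iota 0 (p + n)) => j; rewrite mem_iota add0n -leqNgt.
  move=> hj m hm; rewrite hmon0ZE pserME big1 ?scaler0 // => c _.
  by rewrite (eqoX hf) ?mul0r //; have := ltn_ord c; lia.
congr (sec k _); apply/funext => m.
rewrite (@hsum_nat _ _ _ (p + m).+1); last first.
  move=> j hj; rewrite hmon0ZE pserME big1 ?scaler0 // => c _.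
  by rewrite (eqoX hf) ?mul0r //; have := ltn_ord c; lia.
transitivity ((expN (p + m).+1 f p * s) m); last first.
  rewrite !pserME; apply: eq_bigr => c _; congr (_ * _); apply: esym.
  by apply: (eqo_expt hf); have := ltn_ord c; lia.
rewrite /expN pser_sumE mulr_suml pser_sumE; apply: eq_bigr => j _.
by rewrite /dcst hmon0M -mulrA hmon0M mulr_algl hmon0ZE.
Qed.

Lemma dshE (a : K) f (p : nat) : dsh a f p =
  hsum (fun n => hmon ('C(p + n, n)%:R * a ^+ n) n *: f (p + n)%N).
Proof.
apply/funext => j; rewrite hsum_hmonE; apply: eq_bigr => n _.
by rewrite mulrC -scalerA scaler_nat.
Qed.

Lemma mulfield_shift F f a :
  mulfield F f -> mulfield (fshift a F) (dsh a f).
Proof.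
move=> hF p k s; rewrite /fshift.
under [X in hsum X]eq_fun do rewrite hF -secZ pser_scaleAl.
case: p => p; last first.
  rewrite /= mul0r sec0 -[RHS](@hsum0 nat); congr hsum; apply/funext => n.
  case: (leqP n p) => hn.
    have -> : Negz p + n%:Z = Negz (p - n) by lia.
    by rewrite /= scaler0 mul0r sec0.
  have -> : Negz p + n%:Z = (n - p.+1)%:Z by lia.
  rewrite gbin_nat bin_small ?mul0r; last by lia.
  have -> : hmon (0 : K) n = 0 by apply/funext => j; rewrite /hmon if_same.
  by rewrite scale0r mul0r sec0.
rewrite /zcoef dshE -[LHS](hlin_summable (f := fun x => sec k (x * s))).
- congr (sec k (_ * s)); congr hsum; apply/funext => n.
  by rewrite -PoszD gbin_nat.
- split=> [x y|c x]; first by rewrite mulrDl secD.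
  by rewrite -pser_scaleAl secZ.
- by rewrite -/(zcoef f _); apply: hsummable_hmon.
Qed.

End Multiplication.
End Sectors.

(** * Lowering families *)

Lemma all2_leq_refl l : all2 leq l l.
Proof. by elim: l => //= x l ->; rewrite leqnn. Qed.

Lemma all2_leq_trans l1 l2 l3 :
  all2 leq l1 l2 -> all2 leq l2 l3 -> all2 leq l1 l3.
Proof.
elim: l1 l2 l3 => [|x l1 IH] [|y l2] [|z l3] //= /andP[h1 h2] /andP[h3 h4].
by rewrite (leq_trans h1 h3) (IH _ _ h2 h4).
Qed.

(** Multiples of h inside N.  A congruence modulo hdiv N can be iterated, one
   modulo h in the ambient module cannot. *)
Definition hdiv (K : nzRingType) (V : lmodType K) (N : set (pser V)) :
    set (pser V) :=
  fun s => exists2 t, N t & s = hmon 1 1 *: t.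

Lemma hmon1ZE (K : nzRingType) (V : lmodType K) (x : pser V) m :
  (hmon (1 : K) 1 *: x) m = if m is m'.+1 then x m' else 0.
Proof. by rewrite hmonZE; case: m => [|m] //=; rewrite scale1r subn1. Qed.

(** Dividing by h is continuous. *)
Lemma hclosed_hdiv (K : comNzRingType) (V : lmodType K) (N : set (pser V)) :
  hclosed N -> hclosed (hdiv N).
Proof.
move=> hN; split.
- by exists 0; [apply: closed0|rewrite scaler0].
- move=> x y [t ht ->] [u hu ->]; exists (t + u); first exact: closedD.
  by rewrite scalerDr.
- move=> c x [t ht ->]; exists (c *: t); first exact: closedZ.
  by rewrite !scalerA mulrC.
move=> x hx; have x0 : x 0%N = 0.
  by have [y [t _ ->] e] := hx 1%N; rewrite e // hmon1ZE.
exists (fun n => x n.+1); last by apply/funext => -[|m]; rewrite hmon1ZE.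
apply: (closed_lim hN) => n; have [y [t ht ->] e] := hx n.+1.
by exists t => // m hm; rewrite e // hmon1ZE.
Qed.

Lemma hdiv_sub (K : nzRingType) (V : lmodType K) (N : set (pser V)) :
  hclosed N -> forall x, hdiv N x -> N x.
Proof. by move=> hN x [t ht ->]; apply: closedZ. Qed.

Section Lowering.
Variables (K : numFieldType) (M : fock_model K).
Local Notation A := (fm_alg M).
Local Notation S := (pser A).
Variable ecoef : nat -> S.
Implicit Types (s t : S) (k p : int) (l : seq nat).

Definition hprod l : S := \prod_(x <- l) ecoef x.

Lemma hprod_cons x l : hprod (x :: l) = ecoef x * hprod l.
Proof. by rewrite /hprod big_cons. Qed.

(** The part of the span of the products that an operator of degree -r can
   reach from the product of index l, when each missing unit of the degree is
   paid with a factor h. *)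
Definition lower l r : set S := linspan
  (fun w => exists l' j, [/\ all2 leq l' l, (j + sumn l = sumn l' + r)%N
                           & w = hmon (1 : K) j *: hprod l']).

Definition hspan : set S := hclosure (linspan (fun w => exists l, w = hprod l)).

Lemma hclosed_hspan : hclosed hspan. Proof. exact: hclosed_span. Qed.
Lemma hspan_prod l : hspan (hprod l).
Proof. by apply: hclosure_span_gen; exists l. Qed.

Lemma lower_gen l l' r j : all2 leq l' l -> (j + sumn l = sumn l' + r)%N ->
  forall c : K, lower l r (hmon c j *: hprod l').
Proof.
move=> h1 h2 c; have -> : hmon c j *: hprod l'
    = hmon c 0 *: (hmon (1 : K) j *: hprod l') by rewrite hmonZZ mulr1.
by apply/linspanZ/linspan_gen; exists l', j.
Qed.

Lemma lower_ind l r (N : set S) :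
  N 0 -> (forall x y, N x -> N y -> N (x + y)) ->
  (forall (c : pser K) x, N x -> N (c *: x)) ->
  (forall l' j, all2 leq l' l -> (j + sumn l = sumn l' + r)%N ->
     N (hmon (1 : K) j *: hprod l')) ->
  forall s, lower l r s -> N s.
Proof.
move=> n0 nD nZ h; apply: linspan_sub => // x [l' [j [h1 h2 ->]]]; exact: h.
Qed.

Lemma lower_self l : lower l 0 (hprod l).
Proof.
rewrite -[hprod l]scale1r -hmon1_0.
by apply: lower_gen; rewrite ?all2_leq_refl // addn0.
Qed.

Lemma lower_hmon l r n (c : K) s :
  lower l r s -> lower l (n + r) (hmon c n *: s).
Proof.
move: s; apply: lower_ind => [|x y|d x|l' j h1 h2].
- by rewrite scaler0; apply: linspan0.
- by rewrite scalerDr; apply: linspanD.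
- by rewrite scalerA mulrC -scalerA; apply: linspanZ.
- by rewrite hmonZZ; apply: lower_gen => //; lia.
Qed.

Lemma lower_comp (f : S -> S) l i j s : hlin f ->
  (forall l', lower l' i (f (hprod l'))) ->
  lower l j s -> lower l (i + j) (f s).
Proof.
move=> lf hf; case: (lf) => fD fZ.
move: s; apply: lower_ind => [|x y|d x|l' a h1 h2].
- by rewrite (hlin0 lf); apply: linspan0.
- by rewrite fD; apply: linspanD.
- by rewrite fZ; apply: linspanZ.
rewrite fZ; move: (f _) (hf l'); apply: lower_ind => [|x y|d x|l2 b h3 h4].
- by rewrite scaler0; apply: linspan0.
- by rewrite scalerDr; apply: linspanD.
- by rewrite scalerA mulrC -scalerA; apply: linspanZ.
rewrite hmonZZ; apply: lower_gen; last by lia.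
exact: all2_leq_trans h3 h1.
Qed.

Lemma lower_consl x l r s : lower [:: x] r s -> lower (x :: l) r (s * hprod l).
Proof.
move: s; apply: lower_ind => [|y z|d y|l' j h1 h2].
- by rewrite mul0r; apply: linspan0.
- by rewrite mulrDl; apply: linspanD.
- by rewrite -pser_scaleAl; apply: linspanZ.
case: l' h1 h2 => [|x' [|? ?]] //=; last by rewrite andbF.
rewrite andbT !addn0 => h1 h2.
rewrite -pser_scaleAl /hprod big_seq1 -/(hprod l) -hprod_cons.
by apply: lower_gen; rewrite /= ?h1 ?all2_leq_refl //; lia.
Qed.

Lemma lower_consr x l r s : lower l r s -> lower (x :: l) r (ecoef x * s).
Proof.
move: s; apply: lower_ind => [|y z|d y|l' j h1 h2].
- by rewrite mulr0; apply: linspan0.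
- by rewrite mulrDr; apply: linspanD.
- by rewrite -pser_scaleAr; apply: linspanZ.
rewrite -pser_scaleAr -hprod_cons.
by apply: lower_gen; rewrite /= ?leqnn //; lia.
Qed.

Lemma lower_hspan l r s : lower l r s -> hspan s.
Proof.
have [n0 nD nZ _] := hclosed_hspan.
move: s; apply: lower_ind => // l' j _ _; apply: nZ; exact: hspan_prod.
Qed.

(** The indices of a product can be lowered by at most their sum; the rest of
   the degree is paid in powers of h. *)
Lemma lower_eqh l r s : lower l r s -> eqh (r - sumn l) s 0.
Proof.
move: s; apply: lower_ind => [|x y hx hy|d x hx|l' j h1 h2] //.
- by rewrite -[0]addr0; apply: eqhD.
- by rewrite -(scaler0 _ d); apply: eqhZ.
- by move=> m hm; rewrite hmonZE ifN //; lia.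
Qed.

Lemma lower_hdiv l r s : (sumn l < r)%N -> lower l r s -> hdiv hspan s.
Proof.
move=> hr; have hN := hclosed_hdiv hclosed_hspan; have [n0 nD nZ _] := hN.
move: s; apply: lower_ind => // l' j h1 h2.
exists (hmon (1 : K) j.-1 *: hprod l').
  by apply: (closedZ hclosed_hspan); apply: hspan_prod.
by rewrite hmonZZ mulr1; congr (hmon _ _ *: _); lia.
Qed.

(** The coefficients of degree -r, for each r, of a field made of annihilation
   operators. *)
Record lowering (E : nat -> S -> S) : Prop := {
  low_lin : forall r, hlin (E r);
  low_prod : forall r l, lower l r (E r (hprod l)) }.

Lemma low_hspan E r s : lowering E -> hspan s -> hspan (E r s).
Proof.
move=> [lE pE]; apply: hlin_span (lE r) hclosed_hspan _ s.
by move=> x [l ->]; apply: lower_hspan (pE r l).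
Qed.

(** This is what makes the product of a field of creation type with a lowering
   one summable. *)
Lemma low_small E s n : lowering E -> hspan s ->
  exists B, forall r, (B <= r)%N -> eqh n (E r s) 0.
Proof.
move=> [lE pE] /(_ n) [y hy e].
suff [B hB] : exists B, forall r, (B <= r)%N -> eqh n (E r y) 0.
  exists B => r hr; apply: eqh_trans (hB r hr).
  exact: hlin_eqh (lE r) _ _ _ e.
move: y hy {e}.
apply: linspan_sub => [|x y [B hB] [B' hB']|c x [B hB]|x [l ->]].
- by exists 0%N => r _; rewrite (hlin0 (lE r)).
- exists (B + B')%N => r hr; rewrite (lE r).1 -[0]addr0.
  by apply: eqhD; [apply: hB|apply: hB']; lia.
- exists B => r hr; rewrite (lE r).2 -(scaler0 _ c).
  by apply: eqhZ; apply: hB.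
- exists (n + sumn l)%N => r hr m hm; apply: (lower_eqh (pE r l)).
  by lia.
Qed.

Definition addE (E F : nat -> S -> S) r s := E r s + F r s.
Definition oppE (E : nat -> S -> S) r s := - E r s.
Definition convE (E F : nat -> S -> S) r s :=
  \sum_(j < r.+1) E (r - j)%N (F j s).
Definition oneE (r : nat) s := if r is 0 then s else 0.
Definition expE (E : nat -> S -> S) r s :=
  \sum_(n < r.+1) hmon (n`!%:R^-1 : K) 0 *: iter n (convE E) oneE r s.
Definition shiftE (a : K) (E : nat -> S -> S) r s :=
  \sum_(n < r.+1)
    hmon (gbin (- (r%:Z) + n%:Z)%:~R n * a ^+ n) n *: E (r - n)%N s.

Lemma hlin_bigsum (I : Type) (r : seq I) (P : pred I) (f : I -> S -> S) :
  (forall j, P j -> hlin (f j)) -> hlin (fun s => \sum_(j <- r | P j) f j s).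
Proof.
move=> hf; split=> [x y|c x].
  by rewrite -big_split; apply: eq_bigr => j /hf[fD _]; rewrite fD.
by rewrite scaler_sumr; apply: eq_bigr => j /hf[_ fZ]; rewrite fZ.
Qed.

Lemma hlin_scaled (c : pser K) (f : S -> S) :
  hlin f -> hlin (fun s => c *: f s).
Proof.
move=> [fD fZ]; split=> [x y|d x]; first by rewrite fD scalerDr.
by rewrite fZ !scalerA mulrC.
Qed.

Lemma linspan_bigsum (B : set S) (I : Type) (r : seq I) (P : pred I)
    (F : I -> S) :
  (forall j, P j -> linspan B (F j)) -> linspan B (\sum_(j <- r | P j) F j).
Proof.
by move=> h; apply: big_ind => //; [apply: linspan0|apply: linspanD].
Qed.

Lemma lowering_add E F : lowering E -> lowering F -> lowering (addE E F).
Proof.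
move=> [lE pE] [lF pF]; split=> [r|r l]; last exact: linspanD (pE r l) (pF r l).
split=> [x y|c x]; rewrite /addE; first by rewrite (lE r).1 (lF r).1 addrACA.
by rewrite (lE r).2 (lF r).2 scalerDr.
Qed.

Lemma lowering_opp E : lowering E -> lowering (oppE E).
Proof.
move=> [lE pE]; split=> [r|r l]; last first.
  by rewrite /oppE -scaleN1r; apply: linspanZ; apply: pE.
split=> [x y|c x]; rewrite /oppE; first by rewrite (lE r).1 opprD.
by rewrite (lE r).2 scalerN.
Qed.

Lemma lowering_conv E F : lowering E -> lowering F -> lowering (convE E F).
Proof.
move=> [lE pE] [lF pF]; split=> [r|r l].
  by apply: hlin_bigsum => j _; apply: hlin_comp.
apply: linspan_bigsum => j _; have hj : (j <= r)%N by rewrite -ltnS.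
by rewrite -{1}(subnK hj); apply: lower_comp.
Qed.

Lemma lowering_one : lowering oneE.
Proof.
split=> [[|r]|[|r] l]; rewrite /oneE; [by split| | |].
- by split=> *; rewrite ?addr0 ?scaler0.
- exact: lower_self.
- exact: linspan0.
Qed.

Lemma lowering_iter E n : lowering E -> lowering (iter n (convE E) oneE).
Proof.
move=> hE; elim: n => [|n IH]; first exact: lowering_one.
exact: lowering_conv.
Qed.

Lemma lowering_exp E : lowering E -> lowering (expE E).
Proof.
move=> hE; split=> [r|r l].
  apply: hlin_bigsum => n _; apply: hlin_scaled.
  exact: low_lin (lowering_iter n hE) r.
apply: linspan_bigsum => n _; apply: linspanZ.
exact: low_prod (lowering_iter n hE) r l.
Qed.

Lemma lowering_shift a E : lowering E -> lowering (shiftE a E).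
Proof.
move=> [lE pE]; split=> [r|r l].
  by apply: hlin_bigsum => n _; apply: hlin_scaled.
apply: linspan_bigsum => n _; have hn : (n <= r)%N by rewrite -ltnS.
by rewrite -{1}(subnKC hn); apply: lower_hmon.
Qed.

Lemma expE0 E s : expE E 0 s = s.
Proof. by rewrite /expE big_ord1 /= fact0 invr1 hmon1_0 scale1r. Qed.

(** ** Fields of annihilation type *)

Section Fields.
Variable i : 'I_2.
Local Notation field := (field K i).
Implicit Types (F G : field) (E : nat -> S -> S).

Definition ncoef E p s : S := if p <= 0 then E `|p|%N s else 0.
Definition lowfield F E :=
  forall p k s, F p (sec k s) = sec k (ncoef E p s).

Lemma lowfield_add F G E E' :
  lowfield F E -> lowfield G E' -> lowfield (fadd F G) (addE E E').
Proof.
move=> hF hG p k s; rewrite /fadd hF hG -secD /ncoef.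
by case: ifP => //; rewrite addr0.
Qed.

Lemma lowfield_opp F E : lowfield F E -> lowfield (fopp F) (oppE E).
Proof.
move=> hF p k s; rewrite /fopp hF -secN /ncoef.
by case: ifP => //; rewrite oppr0.
Qed.

Lemma lowfield_mul F G E E' : lowering E ->
  lowfield F E -> lowfield G E' -> lowfield (fmul F G) (convE E E').
Proof.
move=> [lE _] hF hG p k s; rewrite /fmul.
have z q : ~~ (p <= q <= 0) -> F (p - q) (G q (sec k s)) = 0.
  rewrite hG hF /ncoef => hq; case: ifP => h1; last by rewrite sec0.
  case: ifP => h2; last by rewrite (hlin0 (lE _)) sec0.
  by move/negP: hq; case; lia.
rewrite /ncoef; case: ifP => hp; last first.
  rewrite sec0 -[RHS](@hsum0 int); congr hsum; apply/funext => q.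
  by rewrite z //; lia.
apply/funext => m; rewrite (@hsum_down _ _ _ 0 `|p|.+1) => [|q]; last first.
  by apply: contra_neqT => hq; rewrite z //; lia.
rewrite /convE sec_sum pser_sumE; apply: eq_bigr => j _.
have hj : (j <= `|p|)%N by rewrite -ltnS.
rewrite hG hF /ncoef ifT; last by lia.
rewrite ifT; last by lia.
have -> : absz (p - (0 - j%:Z))%R = (`|p| - j)%N by lia.
by have -> : absz (0 - j%:Z)%R = j by lia.
Qed.

Lemma lowfield_iter F E n : lowering E ->
  lowfield F E ->
  lowfield (iter n (fmul F) (fconst id)) (iter n (convE E) oneE).
Proof.
move=> lE hF; elim: n => [|n IH]; last exact: lowfield_mul.
move=> p k s; rewrite /= /fconst /ncoef /oneE.
case: p => [[|p]|p] //=; rewrite ?sec0 //.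
Qed.

(** Convolution powers of a family without term of degree 0 start in the degree
   equal to the exponent, so that the exponential is a finite sum. *)
Lemma iter_convE0 E n r s : lowering E -> (forall s, E 0 s = 0) -> (r < n)%N ->
  iter n (convE E) oneE r s = 0.
Proof.
move=> [lE _] E0; elim: n r s => [|n IH] r s //= hr.
rewrite /convE big1 // => j _.
case: (ltnP j n) => hj; first by rewrite IH // (hlin0 (lE _)).
by have -> : (r - j = 0)%N by have := ltn_ord j; lia.
Qed.

Lemma lowfield_exp F E : lowering E -> (forall s, E 0 s = 0) ->
  lowfield F E -> lowfield (fexp F) (expE E).
Proof.
move=> lE E0 hF p k s; rewrite /fexp.
have h n : iter n (fmul F) (fconst id) p (sec k s) =
           sec k (ncoef (iter n (convE E) oneE) p s) by apply: lowfield_iter.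
apply/funext => m; rewrite (@hsum_nat _ _ _ `|p|.+1); last first.
  move=> n hn; rewrite h /ncoef; case: ifP => _; last by rewrite sec0 scaler0.
  by rewrite iter_convE0 // sec0 scaler0.
rewrite {1}/ncoef /expE; case: ifP => hp; last first.
  rewrite sec0 big1 // => n _; rewrite h /ncoef ifN; last by rewrite hp.
  by rewrite sec0 scaler0.
rewrite sec_sum pser_sumE; apply: eq_bigr => n _.
by rewrite h /ncoef hp secZ.
Qed.

Lemma lowfield_shift F E a :
  lowfield F E -> lowfield (fshift a F) (shiftE a E).
Proof.
move=> hF p k s; rewrite /fshift {1}/ncoef; case: ifP => hp; last first.
  rewrite sec0 -[RHS](@hsum0 nat); congr hsum; apply/funext => n.
  by rewrite hF /ncoef ifN ?sec0 ?scaler0 //; lia.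
apply/funext => m; rewrite (@hsum_nat _ _ _ `|p|.+1); last first.
  by move=> n hn; rewrite hF /ncoef ifN ?sec0 ?scaler0 //; lia.
rewrite /shiftE sec_sum pser_sumE; apply: eq_bigr => n _.
have hn : (n <= `|p|)%N by rewrite -ltnS.
rewrite hF /ncoef ifT; last by lia.
rewrite secZ; have -> : absz (p + n%:Z)%R = (`|p| - n)%N by lia.
by have -> : - (`|p|%N)%:Z = p by lia.
Qed.

End Fields.
End Lowering.

(** * The operator of creation type of the vertex operators *)

Section Series.
Variables (K : numFieldType) (M : fock_model K).
Local Notation A := (fm_alg M).
Local Notation S := (pser A).
Local Notation T := (pser (pser A)).
Implicit Types (s t : S) (f g : T) (k : int) (j : 'I_2).

(** The series sum_{r>0} a_{j+1}(-r) / r u^r. *)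
Definition Aser j : T :=
  fun p => if p is n.+1 then hmon (n.+1%:R^-1 *: fm_var M j n) 0 else 0.

(** The logarithm of E^-(u). *)
Definition bser : T :=
  - dsh (- (3%:R / 4%:R)) (Aser 0) + dsh (4%:R^-1) (Aser 1).

Definition at0 f : T := hmon (f 0%N) 0.

Definition calEser : T := at0 (expt (- bser)) * expt bser.
Definition calEVser : T := expt (- bser) * at0 (expt bser).
Definition ecoef (n : nat) : S := calEser n.

Lemma eqo_Aser j : eqo 1 (Aser j) 0.
Proof. by move=> [|p] [|q]. Qed.

Lemma eqo1_opp f : eqo 1 f 0 -> eqo 1 (- f) 0.
Proof. by move=> h p q hp; rewrite !pserNE h ?oppr0. Qed.

Lemma eqo1_add f g : eqo 1 f 0 -> eqo 1 g 0 -> eqo 1 (f + g) 0.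
Proof. by move=> h h'; rewrite -[0]addr0; apply: eqoD. Qed.

Lemma dsh0 (a : K) : dsh a (0 : T) = 0.
Proof.
apply/funext => p; apply/funext => q; rewrite /dsh big1 // => n _.
by rewrite mul0rn scaler0.
Qed.

Lemma eqo1_dsh (a : K) f : eqo 1 f 0 -> eqo 1 (dsh a f) 0.
Proof. by move=> h; rewrite -(dsh0 a); apply: dsh_eqo. Qed.

Lemma eqo_bser : eqo 1 bser 0.
Proof.
by apply: eqo1_add; [apply: eqo1_opp|]; apply: eqo1_dsh; apply: eqo_Aser.
Qed.

Lemma at0M f g : at0 (f * g) = at0 f * at0 g.
Proof.
apply/funext => p; rewrite /at0 hmon0M /hmon.
by case: p => [|p] /=; rewrite ?mulr0 // pserME big_ord1.
Qed.

Lemma at0N f : at0 (- f) = - at0 f.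
Proof.
by apply/funext => p; rewrite /at0 /hmon !pserNE; case: eqP; rewrite ?oppr0.
Qed.

Lemma at01 : at0 1 = 1.
Proof. by apply/funext => -[|p]. Qed.

Lemma calEserK : calEser * calEVser = 1.
Proof.
rewrite /calEser /calEVser; have := exptN eqo_bser.
move: (expt bser) (expt (- bser)) => e e' h.
have h' : e' * e = 1 by rewrite mulrC.
have -> : at0 e' * e * (e' * at0 e) = (at0 e' * at0 e) * (e * e') by ring.
by rewrite h mulr1 -at0M h' at01.
Qed.

Lemma ecoef0 : ecoef 0 = 1.
Proof.
rewrite /ecoef /calEser /at0 hmon0M.
have := exptN eqo_bser; move: (expt bser) (expt (- bser)) => e e' h.
by have := congr1 (fun x : T => x 0%N) h; rewrite pserME big_ord1 mulrC.
Qed.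

(** ** Their coefficients *)

Local Notation hprod := (hprod ecoef).
Local Notation hspan := (hspan ecoef).

Lemma hspan_1 : hspan 1.
Proof. by have := hspan_prod ecoef [::]; rewrite /hprod big_nil. Qed.

Lemma hspan_ecoef n : hspan (ecoef n).
Proof. by have := hspan_prod ecoef [:: n]; rewrite /hprod big_seq1. Qed.

Lemma hspan_mul s t : hspan s -> hspan t -> hspan (s * t).
Proof.
move=> hs; apply: hlin_span (hlin_mull s) (hclosed_hspan ecoef) _ t => _ [l ->].
rewrite mulrC; move: s hs.
apply: hlin_span (hlin_mull (hprod l)) (hclosed_hspan ecoef) _ => _ [l' ->].
have -> : hprod l * hprod l' = hprod (l ++ l') by rewrite /hprod big_cat.
exact: hspan_prod.
Qed.

(** The coefficients of an inverse series are polynomials in those of the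
   series, as the constant coefficient is 1. *)
Lemma hspan_calEVser p : hspan (calEVser p).
Proof.
have hN := hclosed_hspan ecoef.
elim/ltn_ind: p => p IH.
have e : \sum_(q < p.+1) calEVser q * ecoef (p - q) = (p == 0)%N%:R.
  by have := congr1 (fun x : T => x p) calEserK; rewrite mulrC.
have -> : calEVser p = (p == 0)%N%:R - \sum_(q < p) calEVser q * ecoef (p - q).
  by rewrite -e big_ord_recr /= subnn ecoef0 mulr1 addrC addrK.
apply: (closedD hN).
  by case: (p == 0)%N; [exact: hspan_1|apply: (closed0 hN)].
apply: (closedN hN); apply: (closed_sum _ hN) => q _; apply: hspan_mul.
  exact: IH.
exact: hspan_ecoef.
Qed.

Lemma hspan_dsh (a : K) f :
  (forall p, hspan (f p)) -> forall p, hspan (dsh a f p).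
Proof.
move=> hf p; rewrite dshE; apply: (closed_hsum (hclosed_hspan ecoef)).
  exact: hsummable_hmon.
by move=> n; apply: (closedZ (hclosed_hspan ecoef)).
Qed.

Lemma hspan_zcoef f (p : int) : (forall q, hspan (f q)) -> hspan (zcoef f p).
Proof. by case: p => p //= _; apply: closed0 (hclosed_hspan ecoef). Qed.

(** ** Derivatives of the coefficients *)

Section Derivation.
Variables (j : 'I_2) (n : nat).
Local Notation d := (fm_der (f0 := M) j n).

Lemma derD : {morph d : x y / x + y}. Proof. exact: (fm_der_lin M j n).1. Qed.
Lemma derZ (c : K) x : d (c *: x) = c *: d x.
Proof. exact: (fm_der_lin M j n).2. Qed.
Lemma der0 : d 0 = 0. Proof. by rewrite -{1}(scale0r 0) derZ scale0r. Qed.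
Lemma derMn x m : d (x *+ m) = d x *+ m.
Proof. by rewrite -!scaler_nat derZ. Qed.
Lemma der_sum (I : Type) (r : seq I) (P : pred I) (F : I -> A) :
  d (\sum_(i <- r | P i) F i) = \sum_(i <- r | P i) d (F i).
Proof. exact: (big_morph d derD der0). Qed.

Definition derS s : S := fun m => d (s m).
Definition derT f : T := fun p => derS (f p).

Lemma hlin_derS : hlin derS. Proof. exact: hlin_map (fm_der_lin M j n). Qed.

Lemma derSM s t : derS (s * t) = derS s * t + s * derS t.
Proof.
apply/funext => m; rewrite /derS pserME der_sum pserDE !pserME -big_split.
by apply: eq_bigr => c _; rewrite fm_der_mul.
Qed.

Lemma derTD f g : derT (f + g) = derT f + derT g.
Proof. by apply/funext => p; apply: (hlin_derS).1. Qed.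
Lemma derTN f : derT (- f) = - derT f.
Proof. by apply/funext => p; apply: hlinN hlin_derS _. Qed.

Lemma derTM f g : derT (f * g) = derT f * g + f * derT g.
Proof.
apply/funext => p; rewrite /derT pserME (hlin_sum hlin_derS) pserDE !pserME.
by rewrite -big_split; apply: eq_bigr => c _; rewrite derSM.
Qed.

Lemma derT_dcst (c : K) f : derT (dcst A c * f) = dcst A c * derT f.
Proof.
apply/funext => p; apply/funext => q.
by rewrite /derT /derS !dcstM derZ.
Qed.

Lemma derT_eqo m f : eqo m f 0 -> eqo m (derT f) 0.
Proof. by move=> h p q hp; rewrite /derT /derS h // der0. Qed.

Lemma derT_expt f : eqo 1 f 0 -> derT (expt f) = derT f * expt f.
Proof.
move=> hf; apply: expt_der => //; first exact: derTD.
- exact: derTM.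
- exact: derT_dcst.
- exact: derT_eqo.
Qed.

Lemma derT_at0 f : derT (at0 f) = at0 (derT f).
Proof.
apply/funext => p; rewrite /derT /at0 /hmon; case: eqP => // _.
exact: hlin0 hlin_derS.
Qed.

Lemma derT_dsh (a : K) f : derT (dsh a f) = dsh a (derT f).
Proof.
apply/funext => p; apply/funext => q; rewrite /derT /derS /dsh der_sum.
by apply: eq_bigr => m _; rewrite derZ derMn.
Qed.

(** The derivatives of bser are scalars, homogeneous of degree n + 1 in u and h
   together. *)
Definition homog f := exists kap : nat -> K,
  forall p q, f p q = if (p + q == n.+1)%N then (kap p)%:A else 0.

Lemma homogD f g : homog f -> homog g -> homog (f + g).
Proof.
move=> [kf hf] [kg hg]; exists (fun p => kf p + kg p) => p q.
by rewrite dserDE hf hg; case: ifP => _; rewrite ?addr0 // scalerDl.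
Qed.

Lemma homogN f : homog f -> homog (- f).
Proof.
move=> [kf hf]; exists (fun p => - kf p) => p q.
by rewrite !pserNE hf; case: ifP => _; rewrite ?oppr0 // scaleNr.
Qed.

Lemma homog_dsh (a : K) f : homog f -> homog (dsh a f).
Proof.
move=> [kf hf]; exists (fun p => \sum_(m < (n.+1 - p).+1)
  a ^+ m * kf (p + m)%N * ('C(p + m, m))%:R) => p q.
have e (m : nat) : (m < q.+1)%N ->
    a ^+ m *: (f (p + m)%N (q - m)%N *+ 'C(p + m, m)) =
    if (p + q == n.+1)%N then (a ^+ m * kf (p + m)%N * ('C(p + m, m))%:R)%:A
    else 0.
  rewrite ltnS => hm; rewrite hf.
  have -> : (p + m + (q - m) = p + q)%N by lia.
  case: ifP => _; last by rewrite mul0rn scaler0.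
  by rewrite -scaler_nat !scalerA -!mulrA [kf _ * _]mulrC.
rewrite /dsh; under eq_bigr => m _ do rewrite e //.
case: ifP => [/eqP h|_]; last by rewrite big1.
by rewrite -scaler_suml; have -> : (n.+1 - p = q)%N by lia.
Qed.

Lemma homog_Aser j' : homog (derT (Aser j')).
Proof.
exists (fun p => if (p == n.+1) && (j' == j) then n.+1%:R^-1 else 0) => p q.
rewrite /derT /derS /Aser; case: p => [|p].
  by rewrite der0 /= scale0r if_same.
rewrite /hmon; case: q => [|q] /=.
  rewrite derZ fm_der_var xpair_eqE addn0 !eqSS.
  case: (p =P n) => [->|_] /=; last by rewrite andbF scaler0.
  by rewrite andbT; case: (j' == j); rewrite ?scaler0 ?scale0r.
rewrite der0; case: ifP => // /eqP h.
by rewrite ifN ?scale0r //; apply/negP => /andP[/eqP h' _]; lia.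
Qed.

Lemma homog_bser : homog (derT bser).
Proof.
rewrite derTD derTN !derT_dsh; apply: homogD; last exact/homog_dsh/homog_Aser.
exact/homogN/homog_dsh/homog_Aser.
Qed.

(** Because the derivatives of bser are scalars, each derivation multiplies the
   generating series of the coefficients by a scalar series. *)
Lemma derT_calEser : derT calEser = (derT bser - at0 (derT bser)) * calEser.
Proof.
rewrite /calEser.
have := derT_expt (eqo1_opp eqo_bser); have := derT_expt eqo_bser.
move: (expt bser) (expt (- bser)) => e e' h h'.
rewrite derTM derT_at0 {}h {}h' derTN; move: (derT bser) => D.
by rewrite mulNr at0N at0M; ring.
Qed.

(** By homogeneity of the scalar factor, the term that lowers the index by m
   comes with the power n + 1 - m of h; the value at u = 0 has been
   subtracted, so that m > 0. *)
Lemma derS_ecoef x : lower ecoef [:: x] n.+1 (derS (ecoef x)).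
Proof.
have [kap hk] := homog_bser.
have -> : derS (ecoef x) = derT calEser x by [].
rewrite derT_calEser pserME; apply: linspan_bigsum => m _.
have hm : (m <= x)%N by rewrite -ltnS.
set c := (derT bser - at0 (derT bser)) m.
have -> : c = if (0 < m <= n.+1)%N then hmon (kap m) (n.+1 - m) *: (1 : S)
              else (0 : S).
  apply/funext => q; rewrite /c pserDE pserNE /at0 /hmon pserDE pserNE.
  case: (nat_of_ord m) => [|m'] /=; first by rewrite subrr.
  rewrite subr0 hk.
  case: (leqP m'.+1 n.+1) => h; last by rewrite ifN //; lia.
  rewrite hmonZE; case: (leqP (n.+1 - m'.+1) q) => h1; last first.
    by rewrite ifN //; lia.
  rewrite pser1E subn_eq0.
  case: (leqP q (n.+1 - m'.+1)) => h2; first by rewrite ifT //; lia.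
  by rewrite ifN ?scaler0 //; lia.
case: ifP => h; last by rewrite mul0r; apply: linspan0.
rewrite -pser_scaleAl mul1r.
have -> : calEser (x - m)%N = hprod [:: (x - m)%N] by rewrite /hprod big_seq1.
by apply: lower_gen; rewrite /= ?leq_subr //; lia.
Qed.

Lemma lower_derS l : lower ecoef l n.+1 (derS (hprod l)).
Proof.
elim: l => [|x l IH].
  rewrite /hprod big_nil.
  have -> : derS 1 = 0.
    by apply: (addIr (derS 1)); rewrite add0r -{3}[1]mulr1 derSM mulr1 mul1r.
  exact: linspan0.
rewrite hprod_cons derSM; apply: linspanD.
  exact: lower_consl (derS_ecoef x).
exact: lower_consr.
Qed.
End Derivation.

Definition Dfam j (r : nat) s : S := if r is n.+1 then derS j n s else 0.

Lemma lowering_Dfam j : lowering ecoef (Dfam j).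
Proof.
split=> [[|n]|[|n] l].
- by split=> *; rewrite /= ?addr0 ?scaler0.
- exact: hlin_derS.
- exact: linspan0.
- exact: lower_derS.
Qed.

(** ** The fields of the level 1 action *)

Section Fields.
Variable i : 'I_2.

Lemma mulfield_creat j : mulfield (@creat K i j) (Aser j).
Proof.
have e n v : creat j (Posz n.+1) v =
    hmon (n.+1%:R^-1 : K) 0 *: plift (i := i) (heis j (Negz n)) v by [].
move=> [[|n]|n] k s; first by rewrite /zcoef mul0r sec0.
  rewrite e /zcoef; apply/funext => m; rewrite hmon0ZE /plift /sec fm_creat.
  by rewrite -(fm_sec_lin M k).2 /Aser hmon0M scalerAl.
by rewrite /zcoef mul0r sec0.
Qed.

Lemma lowfield_annih j : lowfield (@annih K i j) (Dfam j).
Proof.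
have e n v : annih j (Negz n) v =
    hmon (n.+1%:R^-1 : K) 0 *: plift (i := i) (heis j (Posz n.+1)) v by [].
move=> [[|n]|n] k s; [by rewrite sec0|by rewrite sec0|].
rewrite e; apply/funext => m; rewrite hmon0ZE /plift /sec fm_annih.
rewrite -(fm_sec_lin M k).2 scalerA mulVf ?scale1r //.
by rewrite pnatr_eq0.
Qed.

Lemma mulfield_Eminus_log : mulfield (@Eminus_log K i) bser.
Proof.
apply: mulfield_add; last exact/mulfield_shift/mulfield_creat.
exact/mulfield_opp/mulfield_shift/mulfield_creat.
Qed.

Lemma mulfield_at0 F f : mulfield F f -> mulfield (@fat0 K i F) (at0 f).
Proof. by move=> hF; apply: mulfield_const => k s; rewrite hF. Qed.

Lemma mulfield_Eminus : mulfield (@Eminus K i) (expt bser).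
Proof. exact: mulfield_exp eqo_bser mulfield_Eminus_log. Qed.

Lemma mulfield_EminusV : mulfield (@EminusV K i) (expt (- bser)).
Proof.
apply: mulfield_exp; first exact/eqo1_opp/eqo_bser.
exact: mulfield_opp mulfield_Eminus_log.
Qed.

Lemma mulfield_calE : mulfield (@calE K i) calEser.
Proof.
apply: mulfield_mul; last exact: mulfield_Eminus.
exact: mulfield_at0 mulfield_EminusV.
Qed.

Lemma mulfield_calEV : mulfield (@calEV K i) calEVser.
Proof.
apply: mulfield_mul; first exact: mulfield_EminusV.
exact: mulfield_at0 mulfield_Eminus.
Qed.

(** Fields of annihilation type given by a lowering family that vanishes in
   degree 0, so that their exponential exists. *)
Definition lowlog (F : field K i) :=
  exists E, [/\ lowering ecoef E, forall s, E 0%N s = 0 & lowfield F E].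

Lemma lowlog_annih j : lowlog (annih j).
Proof.
by exists (Dfam j); split; [apply: lowering_Dfam| |apply: lowfield_annih].
Qed.

Lemma lowlog_opp F : lowlog F -> lowlog (fopp F).
Proof.
move=> [E [h1 h2 h3]]; exists (oppE E); split; first exact: lowering_opp.
  by move=> s; rewrite /oppE h2 oppr0.
exact: lowfield_opp.
Qed.

Lemma lowlog_add F G : lowlog F -> lowlog G -> lowlog (fadd F G).
Proof.
move=> [E [h1 h2 h3]] [E' [h1' h2' h3']]; exists (addE E E').
split; first exact: lowering_add.
  by move=> s; rewrite /addE h2 h2' addr0.
exact: lowfield_add.
Qed.

Lemma lowlog_shift F (a : K) : lowlog F -> lowlog (fshift a F).
Proof.
move=> [E [h1 h2 h3]]; exists (shiftE a E); split; first exact: lowering_shift.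
  by move=> s; rewrite /shiftE big_ord1 h2 scaler0.
exact: lowfield_shift.
Qed.

Lemma lowlog_exp F : lowlog F -> exists E,
  [/\ lowering ecoef E, forall s, E 0%N s = s & lowfield (fexp F) E].
Proof.
move=> [E [h1 h2 h3]]; exists (expE E); split; first exact: lowering_exp.
  exact: expE0.
exact: (lowfield_exp h1 h2 h3).
Qed.

Lemma lowlog_Eplus : lowlog (@Eplus_log K i).
Proof.
apply: lowlog_shift; apply: lowlog_add; first exact: lowlog_annih.
exact/lowlog_opp/lowlog_annih.
Qed.

End Fields.
End Series.

(** * Vertex operators on the sectors of Fock space *)

Lemma hsum_split (V : zmodType) (F : nat -> pser V) B : hsummable F ->
  hsum F = \sum_(r < B) F r + hsum (fun r => F (B + r)%N).
Proof.
move=> sF; apply/funext => n; have [s hs] := sF n.+1.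
pose C := \max_(x <- s) x.+1.
have hC r : (C <= r)%N -> F r n = 0.
  move=> hr; apply: hs => //; apply: contraL hr => /= hin.
  by rewrite -ltnNge /C; apply: leq_trans (leq_bigmax_seq _ hin isT).
rewrite pserDE pser_sumE (@hsum_nat _ F n (B + C)) => [|r hr]; last first.
  by apply: hC; lia.
rewrite (@hsum_nat _ _ n C) => [|r hr]; last by apply: hC; lia.
by rewrite big_split_ord.
Qed.

Section Vertex.
Variables (K : numFieldType) (M : fock_model K) (i : 'I_2).
Local Notation A := (fm_alg M).
Local Notation S := (pser A).
Local Notation T := (pser (pser A)).
Local Notation hspan := (hspan (@ecoef K M)).
Local Notation field := (field K i).
Implicit Types (s t : S) (g : T) (k p e : int) (c : nat -> K)
  (E : nat -> S -> S) (F C L D : field).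

Let hN : hclosed hspan := hclosed_hspan (@ecoef K M).

(** A field that sends the sector of index k to that of index k' by scalars,
   with the expansion sum_n c_n h^n u^(e - n). *)
Definition diagfield D k k' e c := forall q s,
  D q (sec k s) =
  sec k' (if q <= e then hmon (c `|e - q|%N) `|e - q|%N *: s else 0).

(** The coefficient of (h/u)^n in (1 + a h/u)^x (1 + b h/u)^y. *)
Definition pow_coef (a x b y : K) (n : nat) : K :=
  \sum_(l < n.+1) gbin x l * a ^+ l * (gbin y (n - l) * b ^+ (n - l)).

Lemma pow_coef0 a x b y : pow_coef a x b y 0 = 1.
Proof.
by rewrite /pow_coef big_ord1 /gbin !big_ord0 fact0 !divr1 !expr0 !mulr1.
Qed.

Lemma diagfield_fpow (e : int -> int) (a : K) (x : int -> K) (b : K)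
    (y : int -> K) k :
  diagfield (@fpow K i e a x b y) k k (e k) (pow_coef a (x k) b (y k)).
Proof.
move=> q s; rewrite /fpow.
have E1 (n : nat) : hmon (1 : K) n *: plift (i := i) (flin (fun m =>
    if q == e m.2 - n%:Z then
      (\sum_(l < n.+1) gbin (x m.2) l * a ^+ l
                       * (gbin (y m.2) (n - l) * b ^+ (n - l))) *: << m >>
    else 0)) (sec k s) =
   (if q == e k - n%:Z then hmon (pow_coef a (x k) b (y k) n) n else 0)
     *: sec k s.
  pose cc (m : int) : K :=
    if q == e m - n%:Z then pow_coef a (x m) b (y m) n else 0.
  have -> : (fun m : fbasis => if q == e m.2 - n%:Z then
      (\sum_(l < n.+1) gbin (x m.2) l * a ^+ l
         * (gbin (y m.2) (n - l) * b ^+ (n - l))) *: << m >> else 0 : fock0 K)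
    = (fun m => cc m.2 *: << m >>).
    by apply/funext => m; rewrite /cc; case: ifP => // _; rewrite scale0r.
  apply/funext => m; rewrite hmonZE /plift fm_diag /cc.
  case: (q == e k - n%:Z); last by rewrite !scale0r scaler0 if_same.
  by rewrite hmonZE scale1r.
under [X in hsum X]eq_fun do rewrite E1.
case: ifP => hq; last first.
  rewrite sec0 -[RHS](@hsum0 nat); congr hsum; apply/funext => n.
  by rewrite ifN ?scale0r //; lia.
rewrite (@hsum1 _ _ _ `|e k - q|%N) => [|n hn]; last first.
  by rewrite ifN ?scale0r //; apply/eqP => h; move/eqP: hn; apply; lia.
by rewrite ifT ?secZ //; lia.
Qed.

Lemma ealpha_sec d k s : @ealpha K i d (sec k s) = sec (k + d) s.
Proof. by apply/funext => m; rewrite /ealpha /plift /sec fm_shift. Qed.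

Lemma fmul_fconst_ealpha d D p v :
  fmul (fconst (@ealpha K i d)) D p v = ealpha d (D p v).
Proof.
rewrite /fmul (@hsum1 _ _ _ p); first by rewrite /fconst subrr eqxx.
by move=> q hq; rewrite /fconst subr_eq0 eq_sym (negbTE hq).
Qed.

Lemma diagfield_ealpha D d k k' e c : diagfield D k k' e c ->
  diagfield (fmul (fconst (@ealpha K i d)) D) k (k' + d) e c.
Proof. by move=> hD q s; rewrite fmul_fconst_ealpha hD ealpha_sec. Qed.

(** The coefficient of u^{e-r} in the product of the family E with the scalar
   expansion sum_n c_n h^n u^(e - n). *)
Definition lowdiag E c (r : nat) s : S :=
  \sum_(j < r.+1) hmon (c j) j *: E (r - j)%N s.

Lemma fmul_low_diag L D E k k' e c p s : lowering (@ecoef K M) E ->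
  lowfield L E -> diagfield D k k' e c ->
  fmul L D p (sec k s) =
  sec k' (if p <= e then lowdiag E c `|e - p|%N s else 0).
Proof.
move=> [lE _] hL hD; rewrite /fmul.
have z q : ~~ (p <= q <= e) -> L (p - q) (D q (sec k s)) = 0.
  rewrite hD hL /ncoef => hq; case: ifP => h1; last by rewrite sec0.
  case: ifP => h2; last by rewrite (hlin0 (lE _)) sec0.
  by move/negP: hq; case; lia.
case: ifP => hp; last first.
  rewrite sec0 -[RHS](@hsum0 int); congr hsum; apply/funext => q.
  by rewrite z //; lia.
apply/funext => m; rewrite (@hsum_down _ _ _ e `|e - p|.+1) => [|q]; last first.
  by apply: contra_neqT => hq; rewrite z //; lia.
rewrite /lowdiag sec_sum pser_sumE; apply: eq_bigr => j _.
have hj : (j <= `|e - p|)%N by rewrite -ltnS.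
rewrite hD hL /ncoef ifT; last by lia.
rewrite ifT; last by lia.
rewrite (lE _).2; have -> : absz (p - (e - j%:Z))%R = (`|e - p| - j)%N by lia.
by have -> : absz (e - (e - j%:Z))%R = j by lia.
Qed.

Lemma hspan_lowdiag E c r s : lowering (@ecoef K M) E -> hspan s ->
  hspan (lowdiag E c r s).
Proof.
move=> hE hs; apply: (closed_sum _ hN) => j _; apply: (closedZ hN).
exact: low_hspan hE hs.
Qed.

Lemma lowdiag_small E c s n : lowering (@ecoef K M) E -> hspan s ->
  exists B, forall r, (B <= r)%N -> eqh n (lowdiag E c r s) 0.
Proof.
move=> hE hs; have [B hB] := low_small n hE hs.
exists (n + B)%N => r hr m hm; rewrite /lowdiag pser_sumE big1 // => j _.
rewrite hmonZE; case: ifP => // hj.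
by rewrite hB ?scaler0 //; lia.
Qed.

(** The coefficients of a product of a field of creation type with one that
   lowers the degree, as a convergent sum. *)
Definition normal_coef g (Y : nat -> S -> S) p s : S :=
  hsum (fun r : nat => zcoef g (p + r%:Z) * Y r s).

Definition nullat (Y : nat -> S -> S) s :=
  forall n, exists B, forall r, (B <= r)%N -> eqh n (Y r s) 0.

Lemma normal_summable g Y p s : nullat Y s ->
  hsummable (fun r : nat => zcoef g (p + r%:Z) * Y r s).
Proof.
move=> hY n; have [B hB] := hY n; exists (iota 0 B) => r.
rewrite mem_iota add0n leq0n /= -leqNgt => /hB hr.
rewrite -(mulr0 (zcoef g (p + r%:Z))).
exact: hlin_eqh (hlin_mull _) _ _ _ hr.
Qed.

Lemma fmul_mul_low C F g k k' e (Y : nat -> S -> S) p s :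
  mulfield C g -> nullat Y s ->
  (forall q, F q (sec k s) = sec k' (if q <= e then Y `|e - q|%N s else 0)) ->
  fmul C F p (sec k s) = sec k' (normal_coef g Y (p - e) s).
Proof.
move=> hC hY hF; rewrite /normal_coef.
rewrite (hlin_summable (hlin_sec M k')); last first.
  exact: normal_summable.
apply/funext => n; have [B hB] := hY n.+1.
rewrite (@hsum_nat _ _ n B) => [|r /hB hr]; last first.
  have := hlin_eqh (hlin_mull (zcoef g (p - e + r%:Z))) hr.
  move=> /(hlin_eqh (hlin_sec M k')) /(_ n (ltnSn n)) ->.
  by rewrite mulr0 sec0.
rewrite /fmul (@hsum_down _ _ _ e B) => [|q].
  apply: eq_bigr => r _; rewrite hF hC ifT; last by lia.
  have -> : absz (e - (e - r%:Z))%R = r by lia.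
  by congr (sec k' (zcoef g _ * _) n); lia.
apply: contra_neqT => hq; rewrite hF hC; case: ifP => h1; last first.
  by rewrite mulr0 sec0.
have hr : (B <= `|(e - q)%R|)%N by lia.
have := hlin_eqh (hlin_mull (zcoef g (p - q))) (hB _ hr).
move=> /(hlin_eqh (hlin_sec M k')) /(_ n (ltnSn n)) ->.
by rewrite mulr0 sec0.
Qed.

Lemma hspan_normal_coef g (Y : nat -> S -> S) p s :
  (forall q, hspan (g q)) -> nullat Y s -> (forall r, hspan (Y r s)) ->
  hspan (normal_coef g Y p s).
Proof.
move=> hg nY hY; apply: (closed_hsum hN); first exact: normal_summable.
by move=> r; apply: hspan_mul => //; apply: hspan_zcoef.
Qed.

(** In a normally ordered product the diagonal factor acts first, then the
   lowering one, and the creation part last. *)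
Lemma vertex_coef C L D g E k k' e c p s : mulfield C g ->
  lowering (@ecoef K M) E -> lowfield L E -> diagfield D k k' e c -> hspan s ->
  fmul C (fmul L D) p (sec k s) =
  sec k' (normal_coef g (lowdiag E c) (p - e) s).
Proof.
move=> hC hE hL hD hs; apply: (fmul_mul_low _ hC).
  by move=> n; apply: lowdiag_small.
by move=> q; apply: fmul_low_diag hE hL hD.
Qed.

Lemma hspan_vertex g E c p s : (forall q, hspan (g q)) ->
  lowering (@ecoef K M) E -> hspan s -> hspan (normal_coef g (lowdiag E c) p s).
Proof.
move=> hg hE hs; apply: hspan_normal_coef => //.
  by move=> n; apply: lowdiag_small.
by move=> r; apply: hspan_lowdiag.
Qed.

(** ** The three families of operators preserve the span *)

Lemma Xalpha_sec k p s : hspan s ->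
  exists2 t, hspan t & @Xalpha_op K i p (sec k s) = sec (k + 1) t.
Proof.
move=> hs; have [E [hE _ hL]] := lowlog_exp (lowlog_Eplus M i).
have hD := diagfield_ealpha 1
  (@diagfield_fpow (fun k => 2%:Z * k + (i : nat)%:Z)
     0 (halfalpha K i) 1 (halfalpha K i) k).
eexists; last exact: (vertex_coef p (mulfield_calE i) hE hL hD hs).
apply: hspan_vertex => //; exact: hspan_ecoef.
Qed.

Lemma Xmalpha_sec k p s : hspan s ->
  exists2 t, hspan t & @Xmalpha_op K i p (sec k s) = sec (k - 1) t.
Proof.
move=> hs; have [E [hE _ hL]] := lowlog_exp (lowlog_opp (lowlog_Eplus M i)).
have hD := diagfield_ealpha (- 1)
  (@diagfield_fpow (fun k => - (2%:Z * k + (i : nat)%:Z))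
     (- 2%:R^-1) (fun k => - halfalpha K i k)
     (2%:R^-1) (fun k => - halfalpha K i k) k).
eexists; last exact: (vertex_coef p
  (mulfield_shift (2%:R^-1) (mulfield_calEV i)) (lowering_shift (- 2%:R^-1) hE)
  (lowfield_shift (- 2%:R^-1) hL) hD hs).
apply: hspan_vertex => //.
  exact/hspan_dsh/hspan_calEVser.
exact: lowering_shift.
Qed.

Lemma kplus_sec j k p s : hspan s ->
  exists2 t, hspan t & @kplus_op K i j p (sec k s) = sec k t.
Proof.
move=> hs; have hl : lowlog M (fopp (fadd (fshift (2%:R^-1) (@annih K i j))
                         (fopp (fshift (- 2%:R^-1) (annih j))))).
  apply: lowlog_opp; apply: lowlog_add; first exact/lowlog_shift/lowlog_annih.
  exact/lowlog_opp/lowlog_shift/lowlog_annih.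
have [E [hE _ hL]] := lowlog_exp hl.
have hD := @diagfield_fpow (fun=> 0) (4%:R^-1) (halfalpha K i)
  (if j == 0 then 5%:R / 4%:R else - (3%:R / 4%:R))
  (fun k => - halfalpha K i k) k.
eexists; last exact: (fmul_low_diag p s hE hL hD).
by case: (p <= 0); [apply: hspan_lowdiag|apply: closed0].
Qed.

End Vertex.

(** * The submodule as a span of products *)

(** Sums of partial sums: each entry is weighted by the number of entries from
   it on, so moving entries to the right lowers the weight. *)
Fixpoint mweight (l : seq nat) : nat :=
  if l is x :: l' then ((size l').+1 * x + mweight l')%N else 0%N.

Lemma mweight_rcons l x : mweight (rcons l x) = (mweight l + sumn l + x)%N.
Proof.
elim: l => [|y l IH] /=; first by lia.
by rewrite IH size_rcons; lia.
Qed.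

Lemma all2_leq_size l' l : all2 leq l' l -> size l' = size l.
Proof. by elim: l' l => [|a l' IH] [|b l] //= /andP[_ /IH ->]. Qed.

Lemma mweight_lower l' l : all2 leq l' l ->
  (mweight l' + sumn l <= mweight l + sumn l')%N.
Proof.
elim: l' l => [|x l' IH] [|y l] //= /andP[hxy h].
have := IH _ h; have := all2_leq_size h.
by move=> -> ?; nia.
Qed.

Lemma unsorted_descent l : ~~ sorted leq l ->
  exists l1 a b l2, l = l1 ++ a :: b :: l2 /\ (b < a)%N.
Proof.
elim: l => //= a l IH; case: l IH => [|b l] IH //=.
case: (leqP a b) => hab /=; last by move=> _; exists [::], a, b, l.
move=> /IH [l1 [c [d [l2 [e h]]]]].
by exists (a :: l1), c, d, l2; rewrite e.
Qed.

Lemma mweight_swap l1 a b l2 : (b < a)%N ->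
  (mweight (l1 ++ b :: a :: l2) < mweight (l1 ++ a :: b :: l2))%N.
Proof.
move=> h; elim: l1 => [|x l1 IH] /=; last by rewrite !size_cat /=; lia.
by nia.
Qed.

Section Triangular.
Variables (K : numFieldType) (M : fock_model K).
Local Notation A := (fm_alg M).
Local Notation S := (pser A).
Local Notation hspan := (hspan (@ecoef K M)).
Local Notation hprod := (hprod (@ecoef K M)).
Implicit Types (s t : S) (l : seq nat).

Let hN : hclosed hspan := hclosed_hspan (@ecoef K M).
Let hN1 : hclosed (hdiv hspan) := hclosed_hdiv hN.

(** The error term is h times an element of the closed span, not just a multiple
   of h, so that it can be approximated in turn. *)
Definition modspan (P : seq nat -> Prop) s :=
  exists x y, [/\ linspan (fun w => exists2 l, P l & w = hprod l) x,
                  hdiv hspan y & s = x + y].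

Lemma modspan_prod (P : seq nat -> Prop) l : P l -> modspan P (hprod l).
Proof.
move=> hl; exists (hprod l), 0; split; last by rewrite addr0.
  by apply: linspan_gen; exists l.
exact: closed0 hN1.
Qed.

Lemma modspan_hdiv (P : seq nat -> Prop) s : hdiv hspan s -> modspan P s.
Proof.
by move=> hs; exists 0, s; split; rewrite ?add0r //; apply: linspan0.
Qed.

Lemma modspan0 (P : seq nat -> Prop) : modspan P 0.
Proof. exact/modspan_hdiv/(closed0 hN1). Qed.

Lemma modspanD (P : seq nat -> Prop) s t :
  modspan P s -> modspan P t -> modspan P (s + t).
Proof.
move=> [x [y [hx hy ->]]] [x' [y' [hx' hy' ->]]]; exists (x + x'), (y + y').
by split; [apply: linspanD|apply: (closedD hN1)|rewrite addrACA].
Qed.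

Lemma modspanZ (P : seq nat -> Prop) c s : modspan P s -> modspan P (c *: s).
Proof.
move=> [x [y [hx hy ->]]]; exists (c *: x), (c *: y).
by split; [apply: linspanZ|apply: (closedZ hN1)|rewrite scalerDr].
Qed.

Lemma modspan_hspan (P : seq nat -> Prop) s : modspan P s -> hspan s.
Proof.
move=> [x [y [hx hy ->]]]; apply: (closedD hN); last exact: hdiv_sub hy.
move: x hx; apply: linspan_sub => [|x y'|c x|_ [l _ ->]].
- exact: closed0.
- exact: closedD.
- exact: closedZ.
- exact: hspan_prod.
Qed.

Lemma modspan_map (P Q : seq nat -> Prop) (f : S -> S) s :
  f 0 = 0 ->
  (forall s t, hspan s -> hspan t -> f (s + t) = f s + f t) ->
  (forall c s, hspan s -> f (c *: s) = c *: f s) ->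
  (forall s, hspan s -> hspan (f s)) ->
  (forall l, P l -> modspan Q (f (hprod l))) ->
  modspan P s -> modspan Q (f s).
Proof.
move=> f0 fD fZ fh hf [x [y [hx [t ht ->] ->]]].
have sx : hspan x.
  by rewrite -[x]addr0; apply: (@modspan_hspan P); exists x, 0;
    split=> //; apply: (closed0 hN1).
rewrite fD //; last exact: (closedZ hN).
apply: modspanD; last first.
  by apply: modspan_hdiv; rewrite fZ //; exists (f t) => //; apply: fh.
suff [] : hspan x /\ modspan Q (f x) by [].
move: x hx {sx}.
apply: linspan_sub => [|x y' [hx ?] [hy ?]|c x [hx ?]|_ [l hl ->]].
- by rewrite f0; split; [apply: (closed0 hN)|apply: modspan0].
- by rewrite fD //; split; [apply: (closedD hN)|apply: modspanD].
- by rewrite fZ //; split; [apply: (closedZ hN)|apply: modspanZ].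
- by split; [apply: hspan_prod|apply: hf].
Qed.

Definition same_below n d m l :=
  [/\ size l = n, sumn l = d & (mweight l < m)%N].

Variable E : nat -> S -> S.
Variable c : nat -> K.
Hypothesis hE : lowering (@ecoef K M) E.
Hypothesis E0 : forall s, E 0%N s = s.
Hypothesis c0 : c 0%N = 1.

Lemma lowdiag0 s : lowdiag E c 0 s = s.
Proof. by rewrite /lowdiag big_ord1 E0 c0 hmon1_0 scale1r. Qed.

Lemma lowdiag_lead r s : hspan s -> hdiv hspan (lowdiag E c r s - E r s).
Proof.
move=> hs; rewrite /lowdiag big_ord_recl c0 hmon1_0 scale1r subn0 addrC addKr.
apply: (closed_sum _ hN1) => j _.
exists (hmon (c (lift ord0 j)) j *: E (r - lift ord0 j)%N s).
  by apply: (closedZ hN); apply: low_hspan hE hs.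
by rewrite hmonZZ mul1r add1n.
Qed.

Lemma lower_modspan l r s : lower (@ecoef K M) l r s ->
  modspan (fun l' => all2 leq l' l /\ (sumn l' + r = sumn l)%N) s.
Proof.
move: s; apply: lower_ind => [|x y|d x|l' [|j] h1 h2].
- exact: modspan0.
- exact: modspanD.
- exact: modspanZ.
- by rewrite hmon1_0 scale1r; apply: modspan_prod; split=> //; lia.
apply: modspan_hdiv; exists (hmon (1 : K) j *: hprod l').
  by apply: (closedZ hN); apply: hspan_prod.
by rewrite hmonZZ mulr1.
Qed.

(** The coefficient of u^{e+x} in X_alpha(u) on the sector where the diagonal
   factor has leading exponent e. *)
Definition Xi (x : nat) s := normal_coef (@calEser K M) (lowdiag E c) x%:Z s.

Lemma XiD x s t : hspan s -> hspan t -> Xi x (s + t) = Xi x s + Xi x t.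
Proof.
move=> hs ht; rewrite /Xi /normal_coef -hsumD.
- congr hsum; apply/funext => r; rewrite -mulrDr; congr (_ * _).
  rewrite /lowdiag -big_split; apply: eq_bigr => j _.
  by rewrite (low_lin hE _).1 scalerDr.
- by apply: normal_summable => n; apply: lowdiag_small.
- by apply: normal_summable => n; apply: lowdiag_small.
Qed.

Lemma XiZ x d s : hspan s -> Xi x (d *: s) = d *: Xi x s.
Proof.
move=> hs; rewrite /Xi /normal_coef.
have hl : hlin (fun y : S => d *: y).
  by split=> [y z|d' y]; rewrite ?scalerDr // !scalerA mulrC.
rewrite (hlin_summable hl); last first.
  by apply: normal_summable => n; apply: lowdiag_small.
congr hsum; apply/funext => r; rewrite pser_scaleAr; congr (_ * _).
rewrite /lowdiag scaler_sumr; apply: eq_bigr => j _.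
by rewrite (low_lin hE _).2 !scalerA mulrC.
Qed.

Lemma Xi_hspan x s : hspan s -> hspan (Xi x s).
Proof. by move=> hs; apply: hspan_vertex => // q; apply: hspan_ecoef. Qed.

Lemma hdiv_mull s t : hspan s -> hdiv hspan t -> hdiv hspan (s * t).
Proof.
move=> hs [t' ht' ->]; exists (s * t'); first exact: hspan_mul.
by rewrite pser_scaleAr.
Qed.

(** The leading term of a vertex operator coefficient on a product appends one
   factor; the other terms take from the factors and give to the new one. *)
Lemma Xi_prod x l : exists2 t,
  modspan (same_below (size l).+1 (sumn l + x) (mweight (rcons l x))) t &
  Xi x (hprod l) = hprod (rcons l x) + t.
Proof.
have hl := hspan_prod (@ecoef K M) l.
have sm : hsummable (fun r : nat =>
    zcoef (@calEser K M) (x%:Z + r%:Z) * lowdiag E c r (hprod l)).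
  by apply: normal_summable => n; apply: lowdiag_small.
(* Lowering by r = 0 gives the leading product; for r > sumn l, where only
   finitely many units are available, the terms are multiples of h. *)
rewrite /Xi /normal_coef (hsum_split (sumn l).+1 sm) big_ord_recl.
rewrite lowdiag0 addr0.
have -> : zcoef (@calEser K M) x%:Z * hprod l = hprod (rcons l x).
  by rewrite /hprod -cats1 big_cat big_seq1 mulrC.
rewrite -addrA; eexists; last reflexivity.
apply: modspanD; last first.
  apply: modspan_hdiv; apply: (closed_hsum hN1).
    move=> n; have [rs hrs] := sm n.
    exists (map (fun r => r - (sumn l).+1)%N rs).
    move=> r hr; apply: hrs; apply: contra hr => hr; apply/mapP.
    by exists ((sumn l).+1 + r)%N => //; lia.
  move=> r; apply: hdiv_mull.
    by apply: hspan_zcoef => q; apply: hspan_ecoef.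
  rewrite -[lowdiag _ _ _ _](subrK (E ((sumn l).+1 + r)%N (hprod l))).
  apply: (closedD hN1); first exact: lowdiag_lead.
  by apply: lower_hdiv (low_prod hE _ l); lia.
apply: big_ind => [||r _]; [exact: modspan0|exact: modspanD|].
set r' := lift ord0 r; have r'_gt0 : (0 < r')%N by [].
rewrite -PoszD.
have -> : zcoef (@calEser K M) (x + r')%N = ecoef M (x + r') by [].
rewrite -[lowdiag _ _ _ _](subrK (E r' (hprod l))) mulrDr; apply: modspanD.
  by apply/modspan_hdiv/hdiv_mull; [apply: hspan_ecoef|apply: lowdiag_lead].
have := lower_modspan (low_prod hE r' l).
apply: (modspan_map (f := fun s => ecoef M (x + r') * s)).
- by rewrite mulr0.
- by move=> *; rewrite mulrDr.
- by move=> *; rewrite pser_scaleAr.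
- by move=> *; apply: hspan_mul => //; apply: hspan_ecoef.
move=> l' [h1 h2].
have -> : ecoef M (x + r') * hprod l' = hprod (rcons l' (x + r')).
  by rewrite /hprod -cats1 big_cat big_seq1 mulrC.
apply: modspan_prod; split.
- by rewrite size_rcons (all2_leq_size h1).
- by rewrite sumn_rcons; lia.
- by rewrite !mweight_rcons; have := mweight_lower h1; lia.
Qed.

(** Moving units to the right lowers the weight, and appending an entry to all
   indices of the same size and sum preserves the order of their weights. *)
Lemma Xi_lead x l s :
  (exists2 t, modspan (same_below (size l) (sumn l) (mweight l)) t
            & s = hprod l + t) ->
  exists2 t, modspan (same_below (size (rcons l x)) (sumn (rcons l x))
                        (mweight (rcons l x))) t
           & Xi x s = hprod (rcons l x) + t.
Proof.
move=> [t ht ->]; rewrite size_rcons sumn_rcons.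
have Xi0 : Xi x 0 = 0.
  by rewrite -{1}(scale0r (0 : S)) XiZ ?scale0r //; apply: closed0 hN.
have st : hspan t := modspan_hspan ht.
rewrite XiD //; last exact: hspan_prod.
have [t1 ht1 ->] := Xi_prod x l; rewrite -addrA; eexists; last reflexivity.
apply: modspanD => //.
move: ht; apply: modspan_map => // [s' t'|d s'|s'|l' [h1 h2 h3]].
- exact: XiD.
- exact: XiZ.
- exact: Xi_hspan.
have [t2 ht2 ->] := Xi_prod x l'; apply: modspanD.
  apply: modspan_prod; rewrite /same_below size_rcons sumn_rcons !mweight_rcons.
  by split; [rewrite h1|rewrite h2|lia].
move: ht2 => [y [z [hy hz ->]]]; exists y, z; split=> //.
move: y hy; apply: linspan_sub => [|a b|d a|_ [l2 [e1 e2 e3] ->]].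
- exact: linspan0.
- exact: linspanD.
- exact: linspanZ.
apply: linspan_gen; exists l2 => //; split; rewrite ?e1 ?h1 ?e2 ?h2 //.
by move: e3; rewrite !mweight_rcons; lia.
Qed.

End Triangular.

Section Basis.
Variables (K : numFieldType) (M : fock_model K).
Local Notation A := (fm_alg M).
Local Notation S := (pser A).
Local Notation hspan := (hspan (@ecoef K M)).
Local Notation hprod := (hprod (@ecoef K M)).
Implicit Types (s t : S) (l : seq nat).

Let hN : hclosed hspan := hclosed_hspan (@ecoef K M).

(** The explicit description of L_0 and of L_1. *)
Definition fockspan : set (pser (fock0 K)) :=
  hclosure (linspan (fun w => exists k l, w = sec k (hprod l))).

Lemma fockspan_sec k s : hspan s -> fockspan (sec k s).
Proof.
move: s; apply: hlin_span (hlin_sec M k) (hclosed_span _) _ => _ [l ->].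
by apply: hclosure_span_gen; exists k, l.
Qed.

Lemma vac_sec : vac K = sec 0 (1 : S).
Proof.
apply/funext => -[|n]; rewrite /vac /sec pser1E /=; first by rewrite fm_sec_one.
apply: esym; have := congr1 (fun v : pser (fock0 K) => v n) (sec0 M 0); exact.
Qed.

Lemma xmon_hspan rs : exists2 s, hspan s & xmon K rs = sec (size rs)%:Z s.
Proof.
elim/last_ind: rs => [|rs r [s hs e]].
  by exists 1; [apply: hspan_1|apply: vac_sec].
rewrite /xmon foldl_rcons -/(xmon K rs) e size_rcons /xop.
have [t ht ->] := Xalpha_sec 0 (size rs) (- r - 1) hs.
by exists t => //; have -> : (size rs)%:Z + 1 = (size rs).+1 by lia.
Qed.

(** The exponents r_j of the monomial whose leading term is the product of
   index l; the spacing by 2 absorbs the factors (u - v)(u - v + h) that two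
   vertex operators produce. *)
Definition exponents l : seq int :=
  mkseq (fun j => - (nth 0%N l j + 2 * j)%N%:Z - 1) (size l).

Lemma exponents_rcons l x :
  exponents (rcons l x) = rcons (exponents l) (- (x + 2 * size l)%N%:Z - 1).
Proof.
rewrite /exponents size_rcons mkseqS nth_rcons ltnn eqxx; congr rcons.
apply/eq_in_map => j; rewrite mem_iota /= add0n => hj.
by rewrite nth_rcons hj.
Qed.

(** Unitriangularity, one operator at a time: the sector n alpha supplies the
   factor u^{2n}, which turns the exponent 2n + x into the new entry x. *)
Lemma xmon_lead l : exists2 s,
  (exists2 t, modspan (same_below (size l) (sumn l) (mweight l)) t
            & s = hprod l + t) &
  xmon K (exponents l) = sec (size l)%:Z s.
Proof.
elim/last_ind: l => [|l x [s hs e]].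
  exists 1; last exact: vac_sec.
  exists 0; first exact: modspan0.
  by rewrite /hprod big_nil addr0.
have [E [hE E0 hL]] := lowlog_exp (lowlog_Eplus M 0).
have hsp : hspan s.
  case: hs => t ht ->; apply: (closedD hN); first exact: hspan_prod.
  exact: modspan_hspan ht.
pose k := (size l)%:Z.
have hD := diagfield_ealpha 1 (@diagfield_fpow K M 0
  (fun k => 2%:Z * k + (nat_of_ord (0 : 'I_2))%:Z)
  0 (halfalpha K 0) 1 (halfalpha K 0) k).
have := @Xi_lead K M E _ hE E0 (pow_coef0 _ _ _ _) x l s hs.
move=> /(_ 0 (halfalpha K 0 k) 1 (halfalpha K 0 k)) h.
eexists; first exact: h.
rewrite exponents_rcons /xmon foldl_rcons -/(xmon K (exponents l)) e /xop.
rewrite [LHS](vertex_coef _ (mulfield_calE 0) hE hL hD hsp) size_rcons.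
have -> : k + 1 = (size l).+1 by rewrite /k; lia.
apply: (congr1 (fun p => sec _ (normal_coef _ _ p s))).
by rewrite /k /=; lia.
Qed.

Lemma BW0_exponents l : sorted leq l -> BW0 (xmon K (exponents l)).
Proof.
move=> hl; exists (exponents l) => //; apply/andP; split.
  by rewrite /exponents; case: (l) => [|x l'] //=; lia.
apply/(sortedP 0) => j; rewrite size_mkseq => hj.
rewrite !nth_mkseq //; last by lia.
by have := elimT (sortedP 0%N) hl j hj; lia.
Qed.

(* The products of n factors modulo h, in terms of the monomials. *)
Let reached (n : nat) (v : pser (fock0 K)) := exists x t,
  [/\ linspan (fun w => exists l, [/\ sorted leq l, size l = n
                                    & w = xmon K (exponents l)]) x,
      hspan t & v = x + hmon (1 : K) 1 *: sec n%:Z t].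

Lemma reachedD n v w : reached n v -> reached n w -> reached n (v + w).
Proof.
move=> [x [t [hx ht ->]]] [y [u [hy hu ->]]]; exists (x + y), (t + u).
split; [exact: linspanD|exact: (closedD hN)|].
by rewrite secD scalerDr addrACA.
Qed.

Lemma reachedZ n c v : reached n v -> reached n (c *: v).
Proof.
move=> [x [t [hx ht ->]]]; exists (c *: x), (c *: t).
split; [exact: linspanZ|exact: (closedZ hN)|].
by rewrite secZ scalerDr !scalerA mulrC.
Qed.

Lemma reached0 n : reached n 0.
Proof.
exists 0, 0; split; [exact: linspan0|exact: (closed0 hN)|].
by rewrite sec0 scaler0 addr0.
Qed.

(** Induction on the weight. For a weakly increasing index the leading term of
   a monomial is used; otherwise two adjacent entries in decreasing order can
   be exchanged, which does not change the product and lowers the weight. *)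
Lemma prod_reached l : reached (size l) (sec (size l)%:Z (hprod l)).
Proof.
move: {2}(mweight l).+1 (ltnSn (mweight l)) => m.
elim: m l => // m IH l; rewrite ltnS => hm.
have [srt|/unsorted_descent [l1 [a [b [l2 [e hab]]]]]] := boolP (sorted leq l).
  have [s [t ht es] ex] := xmon_lead l.
  have -> : hprod l = s - t by rewrite es addrK.
  rewrite secD secN -ex; apply: reachedD.
    exists (xmon K (exponents l)), 0; split.
    - by apply: linspan_gen; exists l.
    - exact: closed0 hN.
    - by rewrite sec0 scaler0 addr0.
  rewrite -scaleN1r; apply: reachedZ.
  move: ht => [x [_ [hx [u hu ->] ->]]]; rewrite secD secZ; apply: reachedD.
    move: x hx; apply: linspan_sub => [|x y|c x|_ [l' [h1 h2 h3] ->]].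
    - by rewrite sec0; apply: reached0.
    - by rewrite secD; apply: reachedD.
    - by rewrite secZ; apply: reachedZ.
    - by rewrite -h1; apply: IH; apply: leq_trans hm.
  by exists 0, u; split; rewrite ?add0r //; apply: linspan0.
have h := IH (l1 ++ b :: a :: l2).
have e1 : size (l1 ++ b :: a :: l2) = size l by rewrite e !size_cat.
have e2 : hprod (l1 ++ b :: a :: l2) = hprod l.
  by rewrite e /hprod !big_cat !big_cons /= (mulrCA (ecoef M b)).
rewrite -e1 -e2; apply: h; apply: leq_trans hm; rewrite e; exact: mweight_swap.
Qed.

(** Successive approximation: since the products are reached modulo h, they lie
   in the closure. *)
Lemma L0_fockspan (v : fock K 0) : L0_sl2 v <-> fockspan v.
Proof.
pose G' := fun w : pser (fock0 K) =>
  exists k : int, exists2 b, BW0 b & w = @ealpha K 0 k b.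
pose G := fun w => exists k l, w = sec k (hprod l).
split.
  move: v; apply: (hclosure_span_sub (B := G')); first exact: hclosed_span.
  move=> _ [k [_ [rs _ ->] ->]]; have [s hs ->] := xmon_hspan rs.
  by rewrite ealpha_sec; apply: fockspan_sec.
have step y : linspan G y ->
    exists z u, [/\ linspan G' z, fockspan u & y = z + hmon (1 : K) 1 *: u].
  move: y; apply: linspan_sub => [|x y|c x|_ [k [l ->]]].
  - exists 0, 0; split; [exact: linspan0|exact: (closed0 (hclosed_span _))|].
    by rewrite scaler0 addr0.
  - move=> [z [u [hz hu ->]]] [z' [u' [hz' hu' ->]]]; exists (z + z'), (u + u').
    split; [exact: linspanD|exact: (closedD (hclosed_span _))|].
    by rewrite scalerDr addrACA.
  - move=> [z [u [hz hu ->]]]; exists (c *: z), (c *: u).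
    split; [exact: linspanZ|exact: (closedZ (hclosed_span _))|].
    by rewrite scalerDr !scalerA mulrC.
  have [x [t [hx ht e]]] := prod_reached l.
  have la : hlin (fun w : pser (fock0 K) => @ealpha K 0 (k - (size l)%:Z) w).
    by apply: hlin_map; rewrite flinE; apply: klin_lext.
  have -> : sec k (hprod l) =
      @ealpha K 0 (k - (size l)%:Z) (sec (size l)%:Z (hprod l)).
    by rewrite ealpha_sec addrC subrK.
  rewrite e la.1 la.2 ealpha_sec; eexists; eexists; split; [| |reflexivity].
    move: x hx {e}; apply: linspan_sub => [|x y|c x|_ [l' [srt _ ->]]].
    - by rewrite (hlin0 la); apply: linspan0.
    - by rewrite la.1; apply: linspanD.
    - by rewrite la.2; apply: linspanZ.
    - apply: linspan_gen; eexists; exists (xmon K (exponents l')) => //.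
      exact: BW0_exponents.
  exact: fockspan_sec.
have iter_step n y : linspan G y -> exists2 z, linspan G' z & eqh n y z.
  elim: n y => [|n IH] y hy; first by exists 0; [apply: linspan0|].
  have [z [u [hz hu ->]]] := step y hy.
  have [y' hy' e] := hu n; have [z' hz' e'] := IH y' hy'.
  exists (z + hmon (1 : K) 1 *: z').
    by apply: linspanD => //; apply: linspanZ.
  apply: eqhD => // -[|m] hm; rewrite !hmon1ZE // e //; exact: e'.
move=> hv n; have [y hy e] := hv n; have [z hz e'] := iter_step n y hy.
by exists z => // m hm; rewrite e // e'.
Qed.

End Basis.

(** * Series over the completed free algebra *)

Section USeries.
Variable K : numFieldType.
Local Notation yfree := (yfree K).
Implicit Types (f g : useries K) (b : bool) (p q : int).

(** Support in nonpositive degrees if b holds, in nonnegative degrees if not: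
   the products below are then finite sums. *)
Definition usupp b f := forall p, (if b then 0 < p else p < 0) -> f p = 0.

Lemma usupp_one b : usupp b (@uone K).
Proof. by case: b => p hp; rewrite /uone ifN //; lia. Qed.

Lemma usupp_sub b f g : usupp b f -> usupp b g -> usupp b (usub f g).
Proof. by move=> hf hg p hp; rewrite /usub hf // hg // subr0. Qed.

Lemma usupp_tser b i j : usupp b (@tser K b i j).
Proof.
case: b => p hp; rewrite /= /tplus /tminus ifN.
- by rewrite ifN ?subr0 //; lia.
- by rewrite negb_and; apply/orP; right; lia.
- by rewrite ifN ?addr0 //; lia.
- by rewrite negb_and; apply/orP; right; lia.
Qed.

Lemma umul_term0 b f g p q : usupp b f -> usupp b g ->
  ~~ ((- `|p| <= q) && (q <= `|p|)) -> f q * g (p - q) = 0.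
Proof.
move=> hf hg hq; case: b hf hg => hf hg.
  have [h|h] := boolP (0 < q); first by rewrite hf // mul0r.
  by rewrite hg ?mulr0 //; lia.
have [h|h] := boolP (q < 0); first by rewrite hf // mul0r.
by rewrite hg ?mulr0 //; lia.
Qed.

Lemma umulE b f g p : usupp b f -> usupp b g -> umul f g p =
  \sum_(k < (2 * `|p|%N).+1) f (- `|p| + k%:Z) * g (p - (- `|p| + k%:Z)).
Proof.
move=> hf hg; apply/funext => n; rewrite pser_sumE.
apply: hsum_up => q; apply: contra_neqT => hq.
by rewrite (umul_term0 hf hg) //; lia.
Qed.

Lemma usupp_mul b f g : usupp b f -> usupp b g -> usupp b (umul f g).
Proof.
move=> hf hg p hp; rewrite (umulE _ hf hg) big1 // => k _.
set q := - _ + _; case: b hf hg hp => hf hg hp.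
  have [h|h] := boolP (0 < q); first by rewrite hf // mul0r.
  by rewrite hg ?mulr0 //; lia.
have [h|h] := boolP (q < 0); first by rewrite hf // mul0r.
by rewrite hg ?mulr0 //; lia.
Qed.

Lemma usupp_exp b f m : usupp b f -> usupp b (uexp f m).
Proof.
by move=> hf; elim: m => [|m IH]; [apply: usupp_one|apply: usupp_mul].
Qed.

Lemma usupp_inv b f : usupp b f -> usupp b (uinv f).
Proof.
move=> hf p hp; rewrite /uinv -[RHS](@hsum0 nat); congr hsum.
apply/funext => m; apply: usupp_exp hp.
exact: usupp_sub (@usupp_one b) hf.
Qed.

Lemma usupp_shift b c f : usupp b f -> usupp b (ushift c f).
Proof.
move=> hf p hp; rewrite /ushift -[RHS](@hsum0 nat); congr hsum.
apply/funext => k; case: b hf hp => hf hp.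
  by rewrite hf ?mulr0 ?scaler0 //; lia.
have [h|h] := boolP (p + k%:Z < 0); first by rewrite hf // mulr0 scaler0.
have -> : p + k%:Z = (`|(p + k%:Z)%R|%N)%:Z by lia.
rewrite gbin_nat bin_small; last by lia.
have -> : hmon (0 : K) k = 0 by apply/funext => j; rewrite /hmon if_same.
by rewrite scale0r.
Qed.

Lemma usupp_k b j : usupp b (@kser K j b).
Proof.
rewrite /kser; case: ifP => _; first exact: usupp_tser.
rewrite /k2; apply: usupp_sub; first exact: usupp_tser.
apply: usupp_mul; last exact: usupp_tser.
by apply: usupp_mul; [|apply: usupp_inv]; apply: usupp_tser.
Qed.

Definition ucong1 f := forall p, eqh 1 (usub (@uone K) f p) 0.

Lemma ucong1_tser b : ucong1 (@tser K b 0 0).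
Proof.
move=> p [|m] // _; rewrite /usub pserDE pserNE.
have h x : (hmon (1 : K) 1 *: x : yfree) 0%N = 0 by rewrite hmon1ZE.
case: b; rewrite /= /tplus /tminus /uone pserDE ?pserNE /=;
  by case: (p == 0); case: ifP => _; rewrite ?h ?pser0E ?oppr0 ?addr0 ?subrr.
Qed.

Lemma ucong1_shift c f : ucong1 f -> ucong1 (ushift c f).
Proof.
move=> hf p m hm; rewrite -[RHS](hf p m hm) /usub !pserDE !pserNE.
congr (_ - _); case: m hm => [|m] // _.
rewrite /ushift hsum_hmonE big_ord1 subn0 addr0 expr0 mul1r.
by rewrite /gbin big_ord0 fact0 divr1 scale1r.
Qed.

Lemma eqhM0 (B : nzRingType) m n (x y : pser B) :
  eqh m x 0 -> eqh n y 0 -> eqh (m + n) (x * y) 0.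
Proof.
move=> hx hy k hk; rewrite pserME big1 // => j _.
case: (ltnP j m) => hj; first by rewrite hx // mul0r.
by rewrite hy ?mulr0 //; have := ltn_ord j; lia.
Qed.

Lemma uexp_small b f m p : usupp b f -> (forall q, eqh 1 (f q) 0) ->
  eqh m (uexp f m p) 0.
Proof.
move=> hb hf; elim: m p => [|m IH] p //; rewrite /uexp iterS -/(uexp f m).
rewrite (umulE _ hb (usupp_exp _ hb)) => j hj; rewrite pser_sumE big1 // => k _.
by apply: (eqhM0 (hf _) (IH _)); rewrite add1n.
Qed.

Lemma uinv_summable b f p : usupp b f -> ucong1 f ->
  hsummable (fun m : nat => uexp (usub (@uone K) f) m p).
Proof.
move=> hb hf n; exists (iota 0 n) => m; rewrite mem_iota add0n leq0n /= -leqNgt.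
move=> hm j hj; apply: (uexp_small _ (usupp_sub (@usupp_one b) hb) hf).
exact: leq_trans hm.
Qed.

(** ** Subalgebras *)

Section Subalgebra.
Variable N : set yfree.
Hypothesis hN : hclosed N.
Hypothesis N1 : N 1.
Hypothesis NM : forall x y, N x -> N y -> N (x * y).

Definition ucoefs f := forall p, N (f p).

Lemma ucoefs_one : ucoefs (@uone K).
Proof. by move=> p; rewrite /uone; case: ifP => // _; apply: (closed0 hN). Qed.

Lemma ucoefs_sub f g : ucoefs f -> ucoefs g -> ucoefs (usub f g).
Proof. by move=> hf hg p; apply: (closedD hN) => //; apply: closedN hN _. Qed.

Lemma ucoefs_mul b f g : usupp b f -> usupp b g ->
  ucoefs f -> ucoefs g -> ucoefs (umul f g).
Proof.
move=> bf bg hf hg p; rewrite (umulE _ bf bg).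
by apply: (closed_sum _ hN) => k _; apply: NM.
Qed.

Lemma ucoefs_inv b f : usupp b f -> ucong1 f -> ucoefs f -> ucoefs (uinv f).
Proof.
move=> bf uf hf p; apply: (closed_hsum hN); first exact: uinv_summable bf uf.
have bg := usupp_sub (@usupp_one b) bf; have hg := ucoefs_sub ucoefs_one hf.
move=> m; elim: m p => [|m IH] p; first exact: ucoefs_one.
exact: (ucoefs_mul bg (usupp_exp _ bg) hg).
Qed.

Lemma ucoefs_shift c f : N c -> ucoefs f -> ucoefs (ushift c f).
Proof.
move=> ecoef hf p; apply: (closed_hsum hN); first exact: hsummable_hmon.
move=> k; apply: (closedZ hN); apply: NM => //.
by elim: (k) => [|m IH]; rewrite ?expr0 // exprS; apply: NM.
Qed.
End Subalgebra.
End USeries.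

(** * The action of DY(sl_2) *)

Section Inverse.
Variables (K : numFieldType) (A : comAlgType K).
Local Notation S := (pser A).
Local Notation T := (pser (pser A)).
Implicit Types (x y : T).

(** The geometric series converges h-adically when x is divisible by h. *)
Definition geom x : T := fun p => hsum (fun m : nat => (x ^+ m) p).

Lemma eqhX x m p : (forall q, eqh 1 (x q) 0) -> eqh m ((x ^+ m) p) 0.
Proof.
move=> hx; elim: m p => [|m IH] p // j hj.
rewrite exprS pserME pser_sumE big1 // => k _.
by apply: (eqhM0 (hx _) (IH _)); rewrite add1n.
Qed.

Lemma geomE x m p : (forall q, eqh 1 (x q) 0) ->
  eqh m (geom x p) ((\sum_(k < m) x ^+ k) p).
Proof.
move=> hx j hj; rewrite pser_sumE pser_sumE; apply: hsum_nat => k hk.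
by rewrite (eqhX _ hx) //; apply: leq_trans hk.
Qed.

Lemma geomK x : (forall q, eqh 1 (x q) 0) -> (1 - x) * geom x = 1.
Proof.
move=> hx; apply/funext => p; apply: eqh_all => m.
have e : (1 - x) * (\sum_(k < m) x ^+ k) = 1 - x ^+ m.
  by rewrite -[1 - x ^+ m]opprB subrX1 -mulNr opprB.
apply: (@eqh_trans _ _ _ _ (((1 - x) * (\sum_(k < m) x ^+ k)) p)).
  rewrite !pserME; apply: (@eqh_sum K A) => k _.
  by apply: (hlin_eqh (hlin_mull _)); apply: geomE.
by rewrite e => j hj; rewrite !pserDE !pserNE (eqhX _ hx) // subr0.
Qed.
End Inverse.

Section Action.
Variables (K : numFieldType) (M : fock_model K).
Variable act : yfree K -> fock K 1 -> fock K 1.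
Hypothesis hact : level1_action act.
Local Notation A := (fm_alg M).
Local Notation S := (pser A).
Local Notation T := (pser (pser A)).
Local Notation hspan := (hspan (@ecoef K M)).
Local Notation fockspan := (fockspan M).
Local Notation useries := (useries K).
Local Notation half := (hmon (2%:R^-1 : K) 0 *: (1 : yfree K)).

Let hmod := level1_module hact.

Lemma act_hlin_vec a : hlin (act a).
Proof.
by split=> [v w|c v]; [apply: (act_addr hmod)|apply: (act_scaler hmod)].
Qed.

Lemma act_hlin_alg v : hlin (fun a : yfree K => act a v).
Proof.
by split=> [a b|c a]; [apply: (act_addl hmod)|apply: (act_scalel hmod)].
Qed.

Let hF : hclosed fockspan := hclosed_span _.

Definition stable : set (yfree K) :=
  fun a => forall v, fockspan v -> fockspan (act a v).

Lemma hclosed_stable : hclosed stable.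
Proof.
split=> [v hv|a b ha hb v hv|c a ha v hv|a ha v hv].
- by rewrite (hlin0 (act_hlin_alg v)); apply: closed0 hF.
- by rewrite (act_addl hmod); apply: (closedD hF); [apply: ha|apply: hb].
- by rewrite (act_scalel hmod); apply: (closedZ hF); apply: ha.
apply: (closed_lim hF) => n; have [b hb e] := ha n.
exists (act b v); first exact: hb.
exact: hlin_eqh (act_hlin_alg v) _ _ _ e.
Qed.

Lemma stable1 : stable 1.
Proof. by move=> v hv; rewrite (act_one hmod). Qed.

Lemma stableM a b : stable a -> stable b -> stable (a * b).
Proof. by move=> ha hb v hv; rewrite (act_mul hmod); apply/ha/hb. Qed.

Lemma stable_sec a :
  (forall k s, hspan s ->
     exists k', exists2 t, hspan t & act a (sec k s) = sec k' t) ->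
  stable a.
Proof.
move=> h; apply: hlin_span (act_hlin_vec a) hF _ => _ [k [l ->]].
have [k' [t ht ->]] := h k _ (hspan_prod (@ecoef K M) l).
exact: fockspan_sec.
Qed.

Lemma stable_Xalpha p : stable (Xalpha K p).
Proof.
apply: stable_sec => k s hs; rewrite (level1_Xalpha hact).
by have [t ht ->] := Xalpha_sec 1 k p hs; exists (k + 1), t.
Qed.

Lemma stable_Xmalpha p : stable (Xmalpha K p).
Proof.
apply: stable_sec => k s hs; rewrite (level1_Xmalpha hact).
by have [t ht ->] := Xmalpha_sec 1 k p hs; exists (k - 1), t.
Qed.

Lemma stable_kplus j p : stable (@kser K j true p).
Proof.
apply: stable_sec => k s hs; rewrite (level1_k hact) /kop.
by have [t ht ->] := kplus_sec 1 j k p hs; exists k, t.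
Qed.

Lemma stable_half : stable half.
Proof. exact: closedZ hclosed_stable _ _ stable1. Qed.

Lemma ucong1_k1 b : ucong1 (@k1 K b).
Proof. exact: ucong1_tser. Qed.

(** The series k_1^+ and k_2^+ contain only annihilation operators and
   operators that are diagonal on the sectors, so that both preserve the
   submodule. *)
Lemma stable_Hplus p : stable (Hser K true p).
Proof.
have hS := hclosed_stable.
have s1 : usupp true (ushift half (@k1 K true)).
  by apply: usupp_shift; apply: (@usupp_k K true 0).
apply: (ucoefs_mul hS stableM (b := true)).
- by apply: usupp_shift; apply: (@usupp_k K true 1).
- exact: usupp_inv.
- apply: (ucoefs_shift hS stable1 stableM stable_half).
  exact: (stable_kplus 1).
- apply: (ucoefs_inv hS stable1 stableM s1).
    by apply: ucong1_shift; apply: ucong1_k1.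
  apply: (ucoefs_shift hS stable1 stableM stable_half).
  exact: (stable_kplus 0).
Qed.

(** ** The series H^- *)

(** The two factors of H^- do not preserve the submodule separately, so that
   their product is computed.  All the series involved act by multiplication by
   the coefficients of series in T. *)
Definition actmul (f : useries) (g : T) :=
  forall p k s, act (f p) (sec k s) = sec k (zcoef g p * s).

Lemma actmul_one : actmul (@uone K) 1.
Proof.
move=> p k s; rewrite /uone; case: eqP => [->|p0].
  by rewrite (act_one hmod) /zcoef mul1r.
rewrite (hlin0 (act_hlin_alg _)).
by case: p p0 => [[|n]|n] // _; rewrite /zcoef ?pser1E mul0r sec0.
Qed.

Lemma actmul_sub f g x y :
  actmul f x -> actmul g y -> actmul (usub f g) (x - y).
Proof.
move=> hf hg p k s; rewrite /usub (act_hlin_alg _).1 (hlinN (act_hlin_alg _)).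
by rewrite hf hg -secN -secD zcoefD zcoefN mulrDl mulNr.
Qed.

Lemma actmul_mul f g x y : usupp false f -> usupp false g ->
  actmul f x -> actmul g y -> actmul (umul f g) (x * y).
Proof.
move=> sf sg hf hg p k s; case: p => p; last first.
  rewrite (usupp_mul sf sg) // (hlin0 (act_hlin_alg _)) /zcoef mul0r sec0 //.
have -> : umul f g p = \sum_(q < p.+1) f q%:Z * g (p%:Z - q%:Z).
  apply/funext => n; rewrite pser_sumE /umul (@hsum_up _ _ _ 0 p.+1).
    by apply: eq_bigr => q _; rewrite add0r.
  move=> q; apply: contra_neqT => hq; have [h|h] := boolP (q < 0).
    by rewrite sf // mul0r.
  by rewrite sg ?mulr0 //; lia.
rewrite (hlin_sum (act_hlin_alg _)) [zcoef _ _]pserME mulr_suml sec_sum.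
apply: eq_bigr => q _; have hq : (q <= p)%N by rewrite -ltnS.
by rewrite (act_mul hmod) hg hf /zcoef subzn // mulrA.
Qed.

Lemma actmul_exp f x m :
  usupp false f -> actmul f x -> actmul (uexp f m) (x ^+ m).
Proof.
move=> sf hf; elim: m => [|m IH]; first exact: actmul_one.
by rewrite exprS; apply: actmul_mul => //; apply: usupp_exp.
Qed.

(** Divisibility by h can be read off from the action on one vector. *)
Lemma actmul_small f x : (forall p, eqh 1 (f p) 0) -> actmul f x ->
  forall q, eqh 1 (x q) 0.
Proof.
move=> hf hx q [|m] // _.
have := hlin_eqh (act_hlin_alg (sec 0 (1 : S))) (hf q%:Z) (ltnSn 0).
rewrite (hx q%:Z) (hlin0 (act_hlin_alg _)) /zcoef mulr1 -(sec0 M 0).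
exact: fm_sec_inj.
Qed.

(** The inverse is given by a geometric series, and so is the inverse in T. *)
Lemma actmul_inv f x : usupp false f -> ucong1 f -> actmul f x ->
  exists2 y, x * y = 1 & actmul (uinv f) y.
Proof.
move=> sf uf hf; have hx := actmul_sub actmul_one hf.
have sx := usupp_sub (@usupp_one K false) sf.
have x0 := actmul_small uf hx.
exists (geom (1 - x)); first by have := geomK x0; rewrite opprB addrC subrK.
move=> p k s; rewrite /uinv (hlin_summable (act_hlin_alg _)); last first.
  exact: uinv_summable sf uf.
have e m : act (uexp (usub (@uone K) f) m p) (sec k s)
    = sec k (zcoef ((1 - x) ^+ m) p * s) by apply: actmul_exp.
under [X in hsum X]eq_fun do rewrite e.
case: p {e} => p /=; last by rewrite mul0r sec0 hsum0.
rewrite /geom -[LHS](hlin_summable (f := fun y => sec k (y * s))) //.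
  split=> [a b|c a]; first by rewrite mulrDl secD.
  by rewrite -pser_scaleAl secZ.
move=> n; exists (iota 0 n) => m; rewrite mem_iota add0n leq0n /= -leqNgt.
by move=> hm j hj; apply: (eqhX _ x0); apply: leq_trans hm.
Qed.

Lemma halfX k : half ^+ k = hmon ((2%:R^-1 : K) ^+ k) 0 *: (1 : yfree K).
Proof.
elim: k => [|k IH]; first by rewrite expr0 expr0 hmon1_0 scale1r.
rewrite exprS IH; apply/funext => n; rewrite pserME.
under eq_bigr => j _ do rewrite !hmon0ZE !pser1E.
rewrite big_ord_recl big1 ?addr0 => [|j _]; last by rewrite scaler0 mul0r.
by rewrite hmon0ZE pser1E subn0 -scalerAl mul1r scalerA exprS.
Qed.

Lemma actmul_shift f x : actmul f x -> actmul (ushift half f) (dsh (2%:R^-1) x).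
Proof.
move=> hf p k s.
have := @mulfield_shift K M 1 (fun q => act (f q)) x (2%:R^-1) hf p k s.
move=> <-; rewrite /ushift /fshift (hlin_summable (act_hlin_alg _)); last first.
  exact: hsummable_hmon.
congr hsum; apply/funext => n.
rewrite (act_hlin_alg _).2 (act_mul hmod) halfX (act_hlin_alg _).2.
rewrite (act_one hmod).
by rewrite hmonZZ addn0.
Qed.

Definition kminus_log (j : 'I_2) : T :=
  if j == 0 then dsh 1 (Aser M 1) - Aser M 1
  else Aser M 0 - dsh (- 1) (Aser M 0).

Lemma eqo_kminus_log j : eqo 1 (kminus_log j) 0.
Proof.
rewrite /kminus_log; case: ifP => _; apply: eqo1_add.
- by apply: eqo1_dsh; apply: eqo_Aser.
- by apply: eqo1_opp; apply: eqo_Aser.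
- exact: eqo_Aser.
- by apply/eqo1_opp/eqo1_dsh; apply: eqo_Aser.
Qed.

Lemma actmul_kminus j : actmul (@kser K j false) (expt (kminus_log j)).
Proof.
move=> p k s; rewrite (level1_k hact) /=.
suff : mulfield (@kminus_op K 1 j) (expt (kminus_log j)) by exact.
have h := eqo_kminus_log j; move: h; rewrite /kminus_op /kminus_log.
case: ifP => _ h; apply: mulfield_exp h _.
  apply: mulfield_add; first exact/mulfield_shift/mulfield_creat.
  exact/mulfield_opp/mulfield_creat.
apply: mulfield_add; first exact: mulfield_creat.
exact/mulfield_opp/mulfield_shift/mulfield_creat.
Qed.

Lemma dsh_id (x : T) : dsh (0 : K) x = x.
Proof.
apply/funext => p; apply/funext => q; rewrite /dsh big_ord_recl big1 => [|n _].
  by rewrite expr0 scale1r addn0 subn0 bin0 mulr1n addr0.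
by rewrite /= exprS mul0r scale0r.
Qed.

Lemma dsh_calEser (a : K) :
  dsh a (calEser M) = at0 (expt (- bser M)) * expt (dsh a (bser M)).
Proof. by rewrite /calEser dshM (dsh_expt _ (@eqo_bser K M)) dsh_cst. Qed.

(** The quotient of the two series of creation type is a quotient of shifts of
   the series of the vertex operators: the parts outside of sl_2 cancel. *)
Lemma kminus_quotient :
  expt (kminus_log 1) =
  dsh (- 4%:R^-1) (calEser M) * dsh (3%:R / 4%:R) (calEVser M)
  * expt (kminus_log 0).
Proof.
have hb := @eqo_bser K M.
have key : expt (kminus_log 1) * dsh (3%:R / 4%:R) (calEser M)
         = expt (kminus_log 0) * dsh (- 4%:R^-1) (calEser M).
  have e1 := exptD (eqo_kminus_log 1) (eqo1_dsh (3%:R / 4%:R) hb).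
  have e0 := exptD (eqo_kminus_log 0) (eqo1_dsh (- 4%:R^-1) hb).
  have e : kminus_log 1 + dsh (3%:R / 4%:R) (bser M)
         = kminus_log 0 + dsh (- 4%:R^-1) (bser M).
    rewrite /kminus_log /= /bser !dshD !dshN !dsh_dsh.
    have -> : 3%:R / 4%:R + - (3%:R / 4%:R) = 0 :> K by rewrite subrr.
    have -> : 3%:R / 4%:R + 4%:R^-1 = 1 :> K by field.
    have -> : - 4%:R^-1 + - (3%:R / 4%:R) = - 1 :> K by field.
    have -> : - 4%:R^-1 + 4%:R^-1 = 0 :> K by rewrite addNr.
    rewrite !dsh_id; move: (Aser M 0) (Aser M 1) (dsh _ _) (dsh _ _) => a b c d.
    by ring.
  rewrite e e0 in e1; rewrite !dsh_calEser; move: e1.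
  move: (expt (kminus_log 1)) (expt (dsh (3%:R / 4%:R) (bser M))).
  move: (expt (kminus_log 0)) (expt (dsh (- 4%:R^-1) (bser M))).
  move: (at0 _) => c x0 y0 x1 y1 h.
  have -> : x1 * (c * y1) = c * (x1 * y1) by ring.
  by rewrite -h; ring.
have inv : dsh (3%:R / 4%:R) (calEser M) * dsh (3%:R / 4%:R) (calEVser M) = 1.
  by rewrite -dshM calEserK dsh1.
move: key inv.
move: (expt _) (expt _) (dsh _ _) (dsh _ _) (dsh _ _) => x1 x0 a b c key inv.
by rewrite -[LHS]mulr1 -inv mulrA key; ring.
Qed.

Lemma stable_Hminus p : stable (Hser K false p).
Proof.
have s1 : usupp false (ushift half (@k1 K false)).
  by apply: usupp_shift; apply: (@usupp_k K false 0).
have s2 : usupp false (ushift half (@k2 K false)).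
  by apply: usupp_shift; apply: (@usupp_k K false 1).
have u1 : ucong1 (ushift half (@k1 K false)) by apply/ucong1_shift/ucong1_k1.
have [y hy hinv] := actmul_inv s1 u1 (actmul_shift (actmul_kminus 0)).
have hH := actmul_mul s2 (usupp_inv s1) (actmul_shift (actmul_kminus 1)) hinv.
apply: stable_sec => k s hs; exists k; eexists; last exact: hH.
rewrite kminus_quotient dshM -mulrA hy mulr1.
apply: hspan_mul => //; apply: hspan_zcoef; apply: hspan_dsh => q.
rewrite pserME; apply: (closed_sum _ (hclosed_hspan _)) => j _.
apply: hspan_mul.
  by apply: hspan_dsh; apply: hspan_ecoef.
by apply: hspan_dsh; apply: hspan_calEVser.
Qed.

Lemma stable_DYsl2 a : DYsl2 a -> stable a.
Proof.
have hS := hclosed_stable.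
move=> ha; apply: (closed_lim hS) => n; have [b hb e] := ha n; exists b => //.
elim: hb => {a b ha e n}
  [|p|p|[] p|x hx v hv||x y _ hx _ hy|c x _ hx|x y _ hx _ hy].
- by move=> v hv; rewrite (level1_C hact).
- apply: (ucoefs_shift hS stable1 stableM stable_half).
  exact: stable_Xalpha.
- apply: (ucoefs_shift hS stable1 stableM stable_half).
  exact: stable_Xmalpha.
- exact: stable_Hplus.
- exact: stable_Hminus.
- by rewrite (act_ideal hmod v hx); apply: closed0 hF.
- exact: stable1.
- exact: (closedD hS).
- exact: (closedZ hS).
- exact: stableM.
Qed.

Lemma L1_fockspan (v : fock K 1) : L1_sl2 v <-> fockspan v.
Proof.
split=> [[w hw <-]|hv]; first exact/(L0_fockspan M).
by exists v => //; apply/(L0_fockspan M).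
Qed.

End Action.

Theorem theorem3p15 (R : realType)
    (act : yfree R[i] -> fock R[i] 1 -> fock R[i] 1)
    (hact : level1_action act) :
  DYsl2_submodule (M := fock_lmod R[i] 1) act (L1_sl2 (K := R[i])).
Proof.
pose M := polynomial_fock R[i].
have hF : hclosed (fockspan M) := hclosed_span _.
split=> [|v w|c v|a v ha].
- by apply/(L1_fockspan M); apply: closed0 hF.
- move=> /(L1_fockspan M) hv /(L1_fockspan M) hw; apply/(L1_fockspan M).
  exact: (closedD hF).
- by move=> /(L1_fockspan M) hv; apply/(L1_fockspan M); apply: (closedZ hF).
- move=> /(L1_fockspan M) hv; apply/(L1_fockspan M).
  exact: (stable_DYsl2 (M := M) hact ha).
Qed.
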